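(* Let $\Sigma_\pm$ be nondecreasing scalar functions satisfying $\int_\mathbb R (1+t^2)^{-1}d\Sigma_\pm<\infty$, $\int_\mathbb R d\Sigma_\pm=\infty$, $\Sigma_\pm(t)=\frac12(\Sigma_\pm(t-0)+\Sigma_\pm(t+0))$, $\Sigma_\pm(0)=0$, and let $C_\pm$ be real constants such that \[ \int_\mathbb R (1+|t|)^{-1} d\Sigma_\pm < \infty , \qquad C_\pm = \int_\mathbb R t(1+t^2)^{-1} d\Sigma_\pm . \] Then for $\widehat A = \widehat A \{ \Sigma_+ , C_+ , \Sigma_- , C_- \}$: 1) If $\lambda \in \mathfrak{A}_0 (\Sigma_+) \cup \mathfrak{A}_0 (\Sigma_-)$, then $ \lambda \not \in \sigma_p (\widehat A)$. 2) If $\lambda \in \mathfrak{A}_p (\Sigma_+) \cap \mathfrak{A}_p (\Sigma_-)$, then (i) $\lambda$ is an eigenvalue of $\widehat A$ of geometric multiplicity 1; (ii) $\lambda$ is simple if and only if at least one of the following fails: \[ d\Sigma_- (\{ \lambda \} ) = d\Sigma_+ ( \{ \lambda \} ),\quad \int_{\mathbb R \setminus \{\lambda \}} \frac{d \Sigma_+ (t)}{|t-\lambda |^2} < \infty ,\quad \int_{\mathbb R \setminus \{\lambda \}} \frac{d \Sigma_- (t)}{|t-\lambda |^2} < \infty ; \] (iii) if these three conditions hold, the algebraic multiplicity of $\lambda$ is the greatest $k\in\{2,3,\dots\}\cup\{+\infty\}$ such that \[ \int_{\mathbb R \setminus \{\lambda \}} \frac{d \Sigma_\pm (t)}{|t-\lambda|^{2j}}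 < \infty ,\qquad \int_{\mathbb R \setminus \{\lambda \}} \frac{d\Sigma_- (t)}{(t-\lambda )^{j-1}} = \int_{\mathbb R \setminus \{\lambda \}} \frac{d\Sigma_+ (t)}{(t-\lambda )^{j-1}} \] hold for all natural $2 \leq j \leq k-1$ (in particular $k=2$ if one of them fails for $j=2$). 3) If $\lambda \in \mathfrak{A}_r (\Sigma_+) \cap \mathfrak{A}_r (\Sigma_-)$, then $\lambda \in \sigma_p (\widehat A)$ iff $\int_\mathbb R \frac{d\Sigma_+ (t)}{t-\lambda} = \int_\mathbb R \frac{d\Sigma_- (t)}{t-\lambda}$. In this case the geometric multiplicity is 1 and the algebraic multiplicity is the greatest $k\in\{1,2,\dots\}\cup\{+\infty\}$ such that $\int_{\mathbb R} |t-\lambda |^{-2j} d \Sigma_\pm (t) < \infty$ and $\int_{\mathbb R } (t-\lambda )^{-j} d\Sigma_- (t) = \int_{\mathbb R } (t-\lambda )^{-j} d\Sigma_+ (t)$ for all $1 \leq j \leq k$. 4) If $\lambda \in \mathfrak{A}_p (\Sigma_+) \cap \mathfrak{A}_r (\Sigma_-)$ or $\lambda \in \mathfrak{A}_p (\Sigma_-) \cap \mathfrak{A}_r (\Sigma_+)$, then $\lambda \not \in \sigma_p (\widehat A)$.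
   Context: $Q_\Sigma$ is multiplication by $t$ in $L^2(\mathbb R,d\Sigma)$ on its natural domain; $\sigma_c(S):=\{\lambda\notin\sigma_p(S): \operatorname{ran}(S-\lambda)\ne\overline{\operatorname{ran}(S-\lambda)}=H\}$. Sets: $\mathfrak A_0(\Sigma)=\{\lambda\in\sigma_c(Q_\Sigma): \int|t-\lambda|^{-2}d\Sigma=\infty\}$, $\mathfrak A_r(\Sigma)=\{\lambda\notin\sigma_p(Q_\Sigma):\int|t-\lambda|^{-2}d\Sigma<\infty\}$, $\mathfrak A_p(\Sigma)=\sigma_p(Q_\Sigma)$ (the jump points of $\Sigma$); $d\Sigma(\{\lambda\})=\Sigma(\lambda+0)-\Sigma(\lambda-0)$. $T_\Sigma^*$ has domain $\{f=f_Q+\mathfrak c\,t(t^2+1)^{-1}: f_Q\in\operatorname{dom}(Q_\Sigma),\mathfrak c\in\mathbb C\}$, $T_\Sigma^*f=tf_Q-\mathfrak c(t^2+1)^{-1}$; $\Gamma_0^\Sigma f=\mathfrak c$, $\Gamma_1^{\Sigma,C}f=\mathfrak cC+\int f_Q\,d\Sigma$. $\widehat A\{\Sigma_+,C_+,\Sigma_-,C_-\}$ is the restriction of $T_{\Sigma_+}^*\oplus T_{\Sigma_-}^*$ in $L^2(\mathbb R,d\Sigma_+)\oplus L^2(\mathbb R,d\Sigma_-)$ to $\{f_++f_-: \Gamma_0^{\Sigma_+}f_+=\Gamma_0^{\Sigma_-}f_-,\ \Gamma_1^{\Sigma_+,C_+}f_+=\Gamma_1^{\Sigma_-,C_-}f_-\}$.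 *)

(* Defs.v *)
From HB Require Import structures.
From mathcomp Require Import all_boot all_order all_algebra.
From mathcomp Require Import all_classical all_reals all_analysis.
From mathcomp Require Import complex.
Import Order.TTheory GRing.Theory Num.Theory numFieldTopology.Exports.

Set Implicit Arguments.
Unset Strict Implicit.
Unset Printing Implicit Defensive.

Local Open Scope classical_set_scope.
Local Open Scope ring_scope.

(* Scalars are complex numbers C = R[i]; the measure dSigma lives on the
   sigma-algebra of measurableTypeR R (Borel sets of R), which is the
   sigma-algebra of lebesgue_stieltjes_measure.                        *)

Definition rC {R : realType} (x : R) : R[i] := (x%:C)%C.

Definition csq {R : realType} (z : R[i]) : R := complex.Re z ^+ 2 + complex.Im z ^+ 2.

Notation LSmeasure R := {measure set (measurableTypeR R) -> \bar R}.

Definition cmeasurable {R : realType} (f : R -> R[i]) : Prop :=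
  measurable_fun (setT : set (measurableTypeR R)) (fun t : R => complex.Re (f t)) /\
  measurable_fun (setT : set (measurableTypeR R)) (fun t : R => complex.Im (f t)).

(* f is (a representative of) an element of L^2(R, mu) *)
Definition L2 {R : realType} (mu : LSmeasure R) (f : R -> R[i]) : Prop :=
  cmeasurable f /\ (\int[mu]_(t in setT) (csq (f t))%:E < +oo)%E.

Definition ae_eq {R : realType} (mu : LSmeasure R) (f g : R -> R[i]) : Prop :=
  mu.-negligible [set t : R | f t <> g t].

Definition ae_zero {R : realType} (mu : LSmeasure R) (f : R -> R[i]) : Prop :=
  ae_eq mu f (fun=> 0).

Definition dist2 {R : realType} (mu : LSmeasure R) (f g : R -> R[i]) : \bar R :=
  (\int[mu]_(t in setT) (csq (f t - g t))%:E)%E.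

Definition fin_int {R : realType} (mu : LSmeasure R) (A : set R) (g : R -> R)
  : Prop := (\int[mu]_(t in A) (g t)%:E < +oo)%E.

Definition cint {R : realType} (mu : LSmeasure R) (A : set R) (f : R -> R[i])
  : R[i] :=
  Complex (Rintegral mu A (fun t : R => complex.Re (f t)))
          (Rintegral mu A (fun t : R => complex.Im (f t))).

Definition domQ {R : realType} (mu : LSmeasure R) (f : R -> R[i]) : Prop :=
  L2 mu f /\ L2 mu (fun t => rC t * f t).

Definition sigma_p_Q {R : realType} (mu : LSmeasure R) (l : R[i]) : Prop :=
  exists f, domQ mu f /\ ~ ae_zero mu f /\
    ae_eq mu (fun t => rC t * f t) (fun t => l * f t).

Definition ranQ {R : realType} (mu : LSmeasure R) (l : R[i]) (g : R -> R[i])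
  : Prop :=
  L2 mu g /\ exists f, domQ mu f /\ ae_eq mu g (fun t => (rC t - l) * f t).

Definition sigma_c_Q {R : realType} (mu : LSmeasure R) (l : R[i]) : Prop :=
  ~ sigma_p_Q mu l /\
  (forall g, L2 mu g -> forall e : R, 0 < e ->
     exists h, ranQ mu l h /\ (dist2 mu g h < e%:E)%E) /\
  (exists g, L2 mu g /\ ~ ranQ mu l g).

Definition invsq {R : realType} (l : R[i]) (t : R) : R := (csq (rC t - l))^-1.

Definition frakA0 {R : realType} (mu : LSmeasure R) (l : R[i]) : Prop :=
  sigma_c_Q mu l /\ ~ fin_int mu setT (invsq l).

Definition frakAr {R : realType} (mu : LSmeasure R) (l : R[i]) : Prop :=
  ~ sigma_p_Q mu l /\ fin_int mu setT (invsq l).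

Definition frakAp {R : realType} (mu : LSmeasure R) (l : R[i]) : Prop :=
  sigma_p_Q mu l.

Definition Tdecomp {R : realType} (mu : LSmeasure R) (f fQ : R -> R[i])
  (c : R[i]) : Prop :=
  domQ mu fQ /\ ae_eq mu f (fun t => fQ t + c * rC (t / (t ^+ 2 + 1))).

(* T_Sigma^* f = t f_Q - c (t^2+1)^{-1} *)
Definition Tval {R : realType} (fQ : R -> R[i]) (c : R[i]) : R -> R[i] :=
  fun t => rC t * fQ t - c * rC ((t ^+ 2 + 1)^-1).

Definition Gamma1 {R : realType} (mu : LSmeasure R) (C : R) (fQ : R -> R[i])
  (c : R[i]) : R[i] := c * rC C + cint mu setT fQ.

(* vectors of L^2(dSigma_+) (+) L^2(dSigma_-) : pairs of representatives *)
Definition vec (R : realType) := ((R -> R[i]) * (R -> R[i]))%type.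

Definition Ahat_graph {R : realType} (mup : LSmeasure R) (Cp : R)
  (mum : LSmeasure R) (Cm : R) (f g : vec R) : Prop :=
  L2 mup f.1 /\ L2 mum f.2 /\
  exists fQp cp fQm cm,
    Tdecomp mup f.1 fQp cp /\ Tdecomp mum f.2 fQm cm /\
    cp = cm /\                                     (* Gamma_0 condition *)
    Gamma1 mup Cp fQp cp = Gamma1 mum Cm fQm cm /\
    ae_eq mup g.1 (Tval fQp cp) /\ ae_eq mum g.2 (Tval fQm cm).

Definition vzero {R : realType} (mup mum : LSmeasure R) (f : vec R) : Prop :=
  ae_zero mup f.1 /\ ae_zero mum f.2.

Definition vadd {R : realType} (f g : vec R) : vec R :=
  (fun t => f.1 t + g.1 t, fun t => f.2 t + g.2 t).

Definition vscale {R : realType} (a : R[i]) (f : vec R) : vec R :=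
  (fun t => a * f.1 t, fun t => a * f.2 t).

(* f in ker (A - l)^n  (n = 0 : f = 0) *)
Fixpoint root_n {R : realType} (Z : vec R -> Prop) (A : vec R -> vec R -> Prop)
  (l : R[i]) (n : nat) (f : vec R) : Prop :=
  match n with
  | 0 => Z f
  | n'.+1 => exists g, root_n Z A l n' g /\ A f (vadd (vscale l f) g)
  end.

Definition point_spec {R : realType} (Z : vec R -> Prop)
  (A : vec R -> vec R -> Prop) (l : R[i]) : Prop :=
  exists f, ~ Z f /\ root_n Z A l 1 f.

Definition lin_indep {R : realType} (Z : vec R -> Prop) (n : nat)
  (v : 'I_n -> vec R) : Prop :=
  forall a : 'I_n -> R[i],
    Z (fun t => \sum_(i < n) a i * (v i).1 t,
       fun t => \sum_(i < n) a i * (v i).2 t) ->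
    forall i, a i = 0.

Definition has_indep {R : realType} (Z : vec R -> Prop) (S : vec R -> Prop)
  (n : nat) : Prop :=
  exists v : 'I_n -> vec R, (forall i, S (v i)) /\ lin_indep Z v.

Definition has_dim {R : realType} (Z : vec R -> Prop) (S : vec R -> Prop)
  (m : option nat) : Prop :=
  match m with
  | Some n => has_indep Z S n /\ ~ has_indep Z S n.+1
  | None => forall n, has_indep Z S n
  end.

Definition geom_mult {R : realType} (Z : vec R -> Prop)
  (A : vec R -> vec R -> Prop) (l : R[i]) (m : option nat) : Prop :=
  has_dim Z (root_n Z A l 1) m.

Definition alg_mult {R : realType} (Z : vec R -> Prop)
  (A : vec R -> vec R -> Prop) (l : R[i]) (m : option nat) : Prop :=
  has_dim Z (fun f => exists n, root_n Z A l n f) m.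

Definition ole (m' m : option nat) : Prop :=
  match m, m' with
  | None, _ => True
  | Some k, Some k' => (k' <= k)%N
  | Some _, None => False
  end.

Definition ge_lo (lo : nat) (m : option nat) : Prop :=
  forall k, m = Some k -> (lo <= k)%N.

Definition greatest_from (lo : nat) (Q : option nat -> Prop) (m : option nat)
  : Prop :=
  ge_lo lo m /\ Q m /\ forall m', ge_lo lo m' -> Q m' -> ole m' m.

Definition jle (j : nat) (m : option nat) : Prop :=
  match m with None => True | Some k => (j <= k)%N end.

(* Main.v *)
(* Since Gamma_0 f = c fixes f_Q = f - c t/(t^2+1), and the choice of C_+- turns
   Gamma_1 f into the plain integral of f, the equation (A - l) f = g reads
   componentwise (t - l) f = g + c with one constant c for both sides, together
   with the equality of the integrals of f_+ and f_-.  Its solutions are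
   f = (g + c)/(t - l) + a 1_{l}: eigenvectors are multiples of 1/(t - l) when
   neither measure charges l, and of the suitably weighted indicators of {l}
   when both do.  Each such eigenvector starts a Jordan chain made of the powers
   (t - l)^-j; a further power can be appended exactly when it is square
   integrable and the integrals on both sides agree, and a chain that cannot be
   extended spans the root subspace. *)

(* Vectors are representatives, so the shifted operator is only a relation modulo almost everywhere
   null vectors. Its single-valuedness, that a null vector has only null images, rests on the
   infinite total masses, without which the constant c would not be determined by f. When both
   measures charge l, an almost everywhere equation can be evaluated at l. There (t - l) f vanishes,
   so the right side g + c must vanish too. This single observation forces the two masses to be
   equal and explains the exponent j - 1 in part 2. A mismatch of the integrals of (t - l)^-(j-1)
   does not prevent that power from entering the chain, because a multiple of the indicator of l
   repairs it. But the repaired vector no longer vanishes at l, which blocks the following step, the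
   one that needs (t - l)^-j in L^2. Nonreal l needs no separate treatment: the set of real t equal
   to l is then empty and its indicator is zero. *)
Require Import Defs.
From HB Require Import structures.
From mathcomp Require Import all_boot all_order all_algebra.
From mathcomp Require Import all_classical all_reals all_analysis measurable_realfun.
From mathcomp Require Import complex ring lra.
(* [Defs] is imported again so that its [ae_eq] is not shadowed by the one of
   MathComp-Analysis. *)
Import Defs Order.TTheory GRing.Theory Num.Theory numFieldTopology.Exports.
Local Open Scope classical_set_scope.
Local Open Scope ring_scope.

(** * Root vectors of a linear relation *)

Section LinearRelation.
Context {K : fieldType} {V : lmodType K} {Z : V -> Prop} {B : V -> V -> Prop}.
Hypotheses (Z0 : Z 0) (Zlin : forall a f g, Z f -> Z g -> Z (a *: f + g)).
Hypotheses (B0 : B 0 0)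
  (Blin : forall a f g f' g', B f f' -> B g g' -> B (a *: f + g) (a *: f' + g')).
Hypotheses (BZ : forall f g g', B f g -> Z (g' - g) -> B f g')
  (Bfun : forall f g, Z f -> B f g -> Z g).

(** The counterpart of [root_n] with the shift by the eigenvalue absorbed into [B], so that the
    linear algebra below sees only [B], taken modulo [Z]. *)
Fixpoint rel_ker_pow (n : nat) (f : V) : Prop :=
  match n with
  | 0 => Z f
  | n'.+1 => exists g, rel_ker_pow n' g /\ B f g
  end.

Lemma rel_sum (I : finType) (a : I -> K) (f g : I -> V) :
  (forall i, B (f i) (g i)) -> B (\sum_i a i *: f i) (\sum_i a i *: g i).
Proof.
move=> Bfg; elim/big_ind2: _ => // [x1 x2 y1 y2 Bx By|i _].
  by have := Blin 1 _ _ _ _ Bx By; rewrite !scale1r.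
by have := Blin (a i) _ _ _ _ (Bfg i) B0; rewrite !addr0.
Qed.

Lemma rel_null_scale (a : K) (f : V) : Z f -> Z (a *: f).
Proof. by move=> Zf; have := Zlin a _ _ Zf Z0; rewrite addr0. Qed.

Lemma rel_null_add (f g : V) : Z f -> Z g -> Z (f + g).
Proof. by move=> Zf Zg; have := Zlin 1 _ _ Zf Zg; rewrite scale1r. Qed.

Lemma chain_mem_ker_pow (f : nat -> V) (k : nat) : B (f 0%N) 0 ->
  (forall i, (i.+1 < k)%N -> B (f i.+1) (f i)) ->
  forall i, (i < k)%N -> rel_ker_pow i.+1 (f i).
Proof.
move=> Bf0 Bf; elim=> [_|i IHi ltik]; first by exists 0.
by exists (f i); split; [apply: IHi; apply: ltnW|apply: Bf].
Qed.

(** [B] sends a null combination to the combination with indices lowered by one, which is null by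
    [Bfun]. Induction kills every coefficient except the first, and that one dies because [f 0] is
    not null. *)
Lemma chain_free (f : nat -> V) (k : nat) (a : nat -> K) :
  ~ Z (f 0%N) -> B (f 0%N) 0 ->
  (forall i, (i.+1 < k)%N -> B (f i.+1) (f i)) ->
  Z (\sum_(i < k) a i *: f i) -> forall i, (i < k)%N -> a i = 0.
Proof.
move=> Zf0 Bf0; elim: k a => // k IHk a Bf.
rewrite big_ord_recl => Zs.
have Bs : B (a 0%N *: f 0%N + \sum_(i < k) a i.+1 *: f i.+1)
            (\sum_(i < k) a i.+1 *: f i).
  rewrite -[X in B _ X]add0r -[X in B _ (X + _)](scaler0 _ (a 0%N)).
  by apply: Blin => //; apply: rel_sum => i; apply: Bf; rewrite ltnS.
have aS : forall i, (i < k)%N -> a i.+1 = 0.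
  by apply: (IHk (fun i => a i.+1)) => [i ltik|]; [apply: Bf; apply: ltnW|apply: Bfun Bs].
case=> [_|i]; last exact: aS.
apply/eqP/negP => /negP a0; apply: Zf0.
move: Zs; rewrite big1 ?addr0 => [|i _]; last by rewrite aS ?scale0r.
by move=> /(rel_null_scale (a 0%N)^-1); rewrite scalerA mulVf // scale1r.
Qed.

(* If the component a_(k-1) along the top of the chain did not vanish, then
   f, corrected by a combination of the lower chain vectors, would extend the chain. *)
Lemma maximal_chain_spans (f : nat -> V) (k : nat) :
  (forall i, (i.+1 < k.+1)%N -> B (f i.+1) (f i)) ->
  (forall h, rel_ker_pow 1 h -> exists a, Z (h - a *: f 0%N)) ->
  (forall h, ~ B h (f k)) ->
  forall n h, rel_ker_pow n h ->
    exists a : 'I_k.+1 -> K, Z (h - \sum_i a i *: f i).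
Proof.
move=> Bf kerB fmax; elim=> [h Zh|n IHn h [g [/IHn[a Za] Bhg]]].
  by exists (fun=> 0); rewrite big1 ?subr0// => i _; rewrite scale0r.
have Bhs : B h (\sum_i a i *: f i).
  apply: BZ Bhg _; rewrite -opprB -scaleN1r; exact: rel_null_scale.
rewrite big_ord_recr/= in Bhs.
have Bs : B (\sum_(i < k) a (widen_ord (leqnSn k) i) *: f i.+1)
            (\sum_(i < k) a (widen_ord (leqnSn k) i) *: f i).
  by apply: rel_sum => i; apply: Bf; rewrite ltnS.
have := Blin (-1) _ _ _ _ Bs Bhs.
(* The lower terms cancel: [h] minus the raised combination is related to [a ord_max *: f k]
   alone. *)
rewrite !scaleN1r [X in B _ X]addrA addNr add0r [X in B X _]addrC => Bd.
have ak0 : a ord_max = 0.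
  apply/eqP/negP => /negP a0; apply: (fmax ((a ord_max)^-1 *:
    (h - \sum_(i < k) a (widen_ord (leqnSn k) i) *: f i.+1))).
  have := Blin (a ord_max)^-1 _ _ _ _ Bd B0.
  by rewrite !addr0 [X in B _ X]scalerA mulVf// scale1r.
have [|b Zb] := kerB (h - \sum_(i < k) a (widen_ord (leqnSn k) i) *: f i.+1).
  by exists 0; split=> //; rewrite ak0 scale0r in Bd.
(* Coefficients move up by one index, and the freed slot 0 receives the kernel coefficient [b]. *)
exists (fun i => if unlift ord0 i is Some j then a (widen_ord (leqnSn k) j) else b).
rewrite big_ord_recl unlift_none opprD addrA addrAC.
by under [X in _ - X - _]eq_bigr => i _ do rewrite liftK.
Qed.

(** The coefficient matrix has more rows than columns, so a nonzero row vector annihilates it.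
    Combining the [v i] with that row cancels all the [f j] and leaves a null vector. *)
Lemma span_dependent (f : nat -> V) (k : nat) (v : 'I_k.+1 -> V) :
  (forall i, exists a : 'I_k -> K, Z (v i - \sum_j a j *: f j)) ->
  exists a : 'I_k.+1 -> K, Z (\sum_i a i *: v i) /\ exists i, a i != 0.
Proof.
move=> /choice[M ZM]; pose A := \matrix_(i < k.+1, j < k) M i j.
have /rowV0Pn[u /sub_kermxP uA u0] : kermx A != 0.
  rewrite kermx_eq0 /row_free neq_ltn; apply/orP; left.
  by rewrite ltnS rank_leq_col.
exists (fun i => u 0 i); split; last first.
  by have /rV0Pn := u0.
have -> : \sum_i u 0 i *: v i = \sum_i u 0 i *: (v i - \sum_j M i j *: f j).
  under [RHS]eq_bigr => i _ do rewrite scalerBr scaler_sumr.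
  rewrite big_split/= sumrN exchange_big/= [X in _ - X]big1 ?subr0// => j _.
  under eq_bigr => i _ do rewrite scalerA.
  rewrite -scaler_suml; have /rowP/(_ j) := uA; rewrite !mxE.
  under eq_bigr => i _ do rewrite mxE.
  by move=> ->; rewrite scale0r.
by elim/big_ind: _ => // [? ?|i _]; [apply: rel_null_add|apply: rel_null_scale].
Qed.

End LinearRelation.

(** * Complex scalars and measurability *)

Section SquareModulus.
Context {R : realType}.
Implicit Types (x : R) (z w : R[i]).

Lemma csq_ge0 z : 0 <= csq z.
Proof. by rewrite addr_ge0// sqr_ge0. Qed.

Lemma csqM z w : csq (z * w) = csq z * csq w.
Proof. case: z w => [a b] [c d]; rewrite /csq/=; ring. Qed.

Lemma csq_eq0 z : csq z = 0 <-> z = 0.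
Proof.
split=> [|->]; last by rewrite /csq/= expr0n addr0.
case: z => a b /eqP; rewrite /csq/= paddr_eq0 ?sqr_ge0// !sqrf_eq0.
by case/andP => /eqP -> /eqP ->.
Qed.

Lemma csqV z : csq z^-1 = (csq z)^-1.
Proof.
have [->|z0] := eqVneq z 0; first by rewrite invr0 (csq_eq0 0).2// invr0.
have c0 : csq z != 0 by apply/eqP => /csq_eq0/eqP; rewrite (negPf z0).
apply: (mulfI c0); rewrite -csqM mulfV// mulfV//.
by rewrite /csq/= expr1n expr0n addr0.
Qed.

Lemma csqX z n : csq (z ^+ n) = csq z ^+ n.
Proof.
elim: n => [|n IHn]; first by rewrite !expr0 /csq/= expr1n expr0n addr0.
by rewrite !exprS csqM IHn.
Qed.

Lemma csqD_le z w : csq (z + w) <= 2 * csq z + 2 * csq w.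
Proof.
case: z w => [a b] [c d]; rewrite /csq/= -subr_ge0.
rewrite (_ : _ - _ = (a - c) ^+ 2 + (b - d) ^+ 2); last by ring.
by rewrite addr_ge0// sqr_ge0.
Qed.

Lemma csq_rC x : csq (rC x) = x ^+ 2.
Proof. by rewrite /csq/= expr0n addr0. Qed.

Lemma Re_rCM x z : complex.Re (rC x * z) = x * complex.Re z.
Proof. by case: z => a b /=; rewrite mul0r subr0. Qed.

Lemma Im_rCM x z : complex.Im (rC x * z) = x * complex.Im z.
Proof. by case: z => a b /=; rewrite mul0r addr0. Qed.

Lemma ReM z w : complex.Re (z * w) =
  complex.Re z * complex.Re w - complex.Im z * complex.Im w.
Proof. by case: z w => [a b] [c d]. Qed.

Lemma ImM z w : complex.Im (z * w) =
  complex.Re z * complex.Im w + complex.Im z * complex.Re w.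
Proof. by case: z w => [a b] [c d]. Qed.

Lemma ReD z w : complex.Re (z + w) = complex.Re z + complex.Re w.
Proof. by case: z w => [a b] [c d]. Qed.

Lemma ImD z w : complex.Im (z + w) = complex.Im z + complex.Im w.
Proof. by case: z w => [a b] [c d]. Qed.

Lemma ReB z w : complex.Re (z - w) = complex.Re z - complex.Re w.
Proof. by case: z w => [a b] [c d]. Qed.

Lemma ImB z w : complex.Im (z - w) = complex.Im z - complex.Im w.
Proof. by case: z w => [a b] [c d]. Qed.

Lemma ReV z : complex.Re z^-1 = complex.Re z * (csq z)^-1.
Proof. by case: z. Qed.

Lemma ImV z : complex.Im z^-1 = - (complex.Im z * (csq z)^-1).
Proof. by case: z. Qed.

End SquareModulus.

Section ComplexMeasurable.
Context {R : realType}.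
Implicit Types (f g : R -> R[i]) (u : R -> R).

Lemma measurable_inv_ge0 u : (forall t, 0 <= u t) ->
  measurable_fun (setT : set (measurableTypeR R)) u ->
  measurable_fun (setT : set (measurableTypeR R)) (fun t => (u t)^-1).
Proof.
(* The two functions agree also at zeros of [u], where both are 0. *)
move=> u0 mu; rewrite (_ : (fun t => _) = (fun t => powR (u t) (-1))).
  exact: (measurableT_comp (measurable_powR (-1)) mu).
by apply/funext => t; rewrite powR_inv1.
Qed.

Lemma cmeasurable_cst (c : R[i]) : cmeasurable (fun=> c).
Proof. by split; exact: measurable_cst. Qed.

Lemma cmeasurable_rC u : measurable_fun (setT : set (measurableTypeR R)) u ->
  cmeasurable (fun t => rC (u t)).
Proof. by move=> mu; split=> //=; exact: measurable_cst. Qed.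

Lemma cmeasurableD f g : cmeasurable f -> cmeasurable g ->
  cmeasurable (fun t => f t + g t).
Proof.
move=> [f1 f2] [g1 g2]; split.
  by under eq_fun => t do rewrite ReD; exact: measurable_funD.
by under eq_fun => t do rewrite ImD; exact: measurable_funD.
Qed.

Lemma cmeasurableM f g : cmeasurable f -> cmeasurable g ->
  cmeasurable (fun t => f t * g t).
Proof.
move=> [f1 f2] [g1 g2]; split.
  by under eq_fun => t do rewrite ReM; apply: measurable_funB; exact: measurable_funM.
by under eq_fun => t do rewrite ImM; apply: measurable_funD; exact: measurable_funM.
Qed.

Lemma cmeasurable_csq f : cmeasurable f ->
  measurable_fun (setT : set (measurableTypeR R)) (fun t => csq (f t)).
Proof. by move=> [f1 f2]; apply: measurable_funD; exact: measurable_funX. Qed.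

Lemma cmeasurableV f : cmeasurable f -> cmeasurable (fun t => (f t)^-1).
Proof.
move=> mf; have mi := measurable_inv_ge0 _ (fun t => csq_ge0 (f t)) (cmeasurable_csq _ mf).
case: mf => f1 f2; split.
  by under eq_fun => t do rewrite ReV; exact: measurable_funM.
under eq_fun => t do rewrite ImV.
by apply: (measurableT_comp (@oppr_measurable _ _)); exact: measurable_funM.
Qed.

Lemma cmeasurableX f n : cmeasurable f -> cmeasurable (fun t => f t ^+ n).
Proof.
move=> mf; elim: n => [|n IHn].
  by under eq_fun => t do rewrite expr0; exact: cmeasurable_cst.
by under eq_fun => t do rewrite exprS; exact: cmeasurableM.
Qed.

Lemma cmeasurable_resolvent (l : R[i]) : cmeasurable (fun t => (rC t - l)^-1).
Proof.
apply: cmeasurableV; apply: cmeasurableD (cmeasurable_cst _).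
by apply: cmeasurable_rC; exact: measurable_id.
Qed.

Lemma measurable_real_point (l : R[i]) :
  measurable ([set t : R | rC t = l] : set (measurableTypeR R)).
Proof.
case: l => a b; have [->|b0] := eqVneq b 0.
  rewrite (_ : [set t | _] = [set a]); first exact: (measurable_set1 a).
  by apply/seteqP; split => t /= => [[]|->].
rewrite (_ : [set t | _] = set0); first exact: measurable0.
by apply/seteqP; split => t //= -[_ /esym/eqP]; rewrite (negPf b0).
Qed.

End ComplexMeasurable.

(** * Square-integrable functions and complex integrals *)

Definition cintegrable {R : realType} (mu : LSmeasure R) (f : R -> R[i]) : Prop :=
  mu.-integrable setT (EFin \o (fun t => complex.Re (f t))) /\
  mu.-integrable setT (EFin \o (fun t => complex.Im (f t))).

Definition point_ind {R : realType} (l : R[i]) (t : R) : R[i] :=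
  rC (\1_[set s : R | rC s = l] t).

Section LSIntegration.
Context {R : realType} {mu : LSmeasure R}.
Implicit Types (f g : R -> R[i]) (u v : R -> R) (a c l : R[i]).

Local Notation measR u := (measurable_fun (setT : set (measurableTypeR R)) u).

Lemma ae_imp {f g f' g'} : ae_eq mu f g ->
  (forall t, f t = g t -> f' t = g' t) -> ae_eq mu f' g'.
Proof. by move=> fg imp; apply: negligibleS fg => t /= nfg /imp. Qed.

Lemma ae_imp2 {f g f' g' f'' g''} : ae_eq mu f g -> ae_eq mu f' g' ->
  (forall t, f t = g t -> f' t = g' t -> f'' t = g'' t) -> ae_eq mu f'' g''.
Proof.
move=> fg fg' imp; apply: negligibleS (negligibleU fg fg') => t /= nfg.
by apply: contrapT => /not_orP[/contrapT fgt /contrapT fgt']; apply/nfg/imp.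
Qed.

Lemma ae_refl f : ae_eq mu f f.
Proof. by apply: negligibleS (negligible_set0 mu) => t /=. Qed.

Lemma ae_real (f g : R -> R[i]) (V : Type) (h : R[i] -> V) : ae_eq mu f g ->
  h \o f = h \o g %[ae mu in setT].
Proof. by move=> fg; apply: negligibleS fg => t /= nfg fgt; apply: nfg => _; rewrite /= fgt. Qed.

Lemma fin_int_integrable u : measR u -> (forall t, 0 <= u t) ->
  fin_int mu setT u <-> mu.-integrable setT (EFin \o u).
Proof.
move=> mesu u0; have abs_u : (\int[mu]_(x in setT) `|(EFin \o u) x| =
    \int[mu]_(x in setT) (u x)%:E)%E.
  by apply: eq_integral => t _ /=; rewrite ger0_norm.
split=> [fu|/integrableP[_]]; last by rewrite abs_u.
by apply/integrableP; split; [exact/measurable_EFinP|rewrite abs_u].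
Qed.

Lemma integrable_le u v : measR u -> (forall t, `|u t| <= v t) ->
  mu.-integrable setT (EFin \o v) -> mu.-integrable setT (EFin \o u).
Proof.
move=> mesu uv; apply: le_integrable => //; first exact/measurable_EFinP.
by move=> t _ /=; rewrite lee_fin (le_trans (uv t))// ler_norm.
Qed.

Lemma L2P f : L2 mu f <->
  cmeasurable f /\ mu.-integrable setT (EFin \o (fun t => csq (f t))).
Proof.
split=> -[mf If]; split=> //; apply/fin_int_integrable => //;
  by [exact: cmeasurable_csq|move=> t; exact: csq_ge0].
Qed.

Lemma integrable_linear (k : R) u v : mu.-integrable setT (EFin \o u) ->
  mu.-integrable setT (EFin \o v) ->
  mu.-integrable setT (EFin \o (fun t => k * u t + v t)).
Proof.
move=> Iu Iv; rewrite (_ : _ \o _ =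
  ((fun t => k%:E * (EFin \o u) t) \+ (EFin \o v))%E) //.
by apply: integrableD => //; exact: integrableZl.
Qed.

Lemma L2_linear a f g : L2 mu f -> L2 mu g -> L2 mu (fun t => a * f t + g t).
Proof.
move=> /L2P[mf If] /L2P[mg Ig].
have mh : cmeasurable (fun t => a * f t + g t).
  by apply: cmeasurableD mg; apply: cmeasurableM mf; exact: cmeasurable_cst.
apply/L2P; split=> //.
apply: (integrable_le _ (fun t => (2 * csq a) * csq (f t) + (1 * csq (g t) + csq (g t)))).
- exact: cmeasurable_csq.
- move=> t; rewrite ger0_norm ?csq_ge0//; apply: le_trans (csqD_le _ _) _.
  by rewrite csqM mul1r mulrA lerD2l mulr_natl mulr2n.
- by apply: integrable_linear => //; exact: integrable_linear.
Qed.

Lemma L2_0 : L2 mu (fun=> 0).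
Proof.
split; first exact: cmeasurable_cst.
by rewrite (csq_eq0 0).2// integral0.
Qed.

Lemma L2_scale a f : L2 mu f -> L2 mu (fun t => a * f t).
Proof.
by move=> /(L2_linear a)/(_ L2_0); under eq_fun => t do rewrite addr0.
Qed.

Lemma L2_ae f g : L2 mu f -> cmeasurable g -> ae_eq mu f g -> L2 mu g.
Proof.
move=> /L2P[mf If] mg fg; split=> //.
have <- : (\int[mu]_(t in setT) (csq (f t))%:E = \int[mu]_(t in setT) (csq (g t))%:E)%E.
  apply: ae_eq_integral => //; try by apply/measurable_EFinP; exact: cmeasurable_csq.
  exact: (ae_real _ _ _ (fun z => (csq z)%:E)).
by apply/fin_int_integrable => // [|t]; [exact: cmeasurable_csq|exact: csq_ge0].
Qed.

Lemma L2_cst_eq0 c : mu setT = +oo%E -> L2 mu (fun=> c) -> c = 0.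
Proof.
move=> muT [_]; rewrite integral_cst//= muT => fin.
apply/csq_eq0/eqP; rewrite eq_le csq_ge0 andbT leNgt; apply/negP => c0.
by move: fin; rewrite gt0_muley.
Qed.

Lemma integrable_scale (k : R) u : mu.-integrable setT (EFin \o u) ->
  mu.-integrable setT (EFin \o (fun t => k * u t)).
Proof. by move=> Iu; apply: (integrableZl measurableT k Iu). Qed.

Lemma cintegrableZ a f : cintegrable mu f -> cintegrable mu (fun t => a * f t).
Proof.
move=> [f1 f2]; split.
- under eq_fun => t do rewrite ReM -mulNr.
  by apply: integrable_linear => //; exact: integrable_scale.
- under eq_fun => t do rewrite ImM.
  by apply: integrable_linear => //; exact: integrable_scale.
Qed.

Lemma cintD f g : cintegrable mu f -> cintegrable mu g ->
  cint mu setT (fun t => f t + g t) = cint mu setT f + cint mu setT g.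
Proof.
move=> [f1 f2] [g1 g2]; rewrite /cint.
under eq_fun => t do rewrite ReD.
under [X in Complex _ (Rintegral _ _ X)]eq_fun => t do rewrite ImD.
by rewrite !RintegralD.
Qed.

Lemma cintZ a f : cintegrable mu f ->
  cint mu setT (fun t => a * f t) = a * cint mu setT f.
Proof.
move=> [f1 f2]; rewrite /cint.
under eq_fun => t do rewrite ReM -mulNr.
under [X in Complex _ (Rintegral _ _ X)]eq_fun => t do rewrite ImM.
rewrite !RintegralD ?RintegralZl//; try exact: integrable_scale.
by case: a => x y /=; rewrite mulNr.
Qed.

Lemma cint_ae f g : cmeasurable f -> cmeasurable g -> ae_eq mu f g ->
  cint mu setT f = cint mu setT g.
Proof.
move=> [f1 f2] [g1 g2] fg; rewrite /cint /Rintegral; congr (Complex (fine _) (fine _));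
  apply: ae_eq_integral => //; try exact/measurable_EFinP.
- exact: (ae_real _ _ _ (fun z => (complex.Re z)%:E)).
- exact: (ae_real _ _ _ (fun z => (complex.Im z)%:E)).
Qed.

Lemma cint_setC_vanish (E : set R) f : (forall t, E t -> f t = 0) ->
  cint mu (~` E) f = cint mu setT f.
Proof.
move=> f0; rewrite /cint !(Rintegral_mkcond mu (~` E)).
by congr (Complex _ _); congr (Rintegral mu setT _); apply/funext => t;
  rewrite patchE; case: ifPn => //; rewrite in_setC negbK inE => /f0 ->.
Qed.

Lemma fin_int_setC_vanish (E : set R) u : (forall t, E t -> u t = 0) ->
  fin_int mu (~` E) u <-> fin_int mu setT u.
Proof.
move=> u0; rewrite /fin_int (integral_mkcond (~` E : set (measurableTypeR R))).
rewrite (_ : _ \_ _ = EFin \o u)//; apply/funext => t; rewrite patchE.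
by case: ifPn => //; rewrite in_setC negbK inE => /u0/= ->.
Qed.

End LSIntegration.

(** * The eigenvalue equation in one component *)

(* One component of (A - l) f = g with Gamma_0 f = c: the decomposition
   f = f_Q + c t/(t^2+1) is absorbed in the condition that t f - c be in L^2. *)
Definition eqn_comp {R : realType} (mu : LSmeasure R) (l c : R[i]) (f g : R -> R[i]) : Prop :=
  [/\ L2 mu f, L2 mu (fun t => rC t * f t - c) &
      ae_eq mu (fun t => (rC t - l) * f t) (fun t => g t + c)].

(* At t = l the value is 0 for 0 < j, by the convention 0^-1 = 0, so integrals of
   [rpow l j.+1] over the line and off the point l coincide. *)
Definition rpow {R : realType} (l : R[i]) (j : nat) (t : R) : R[i] :=
  ((rC t - l) ^+ j)^-1.

Section Component.
Context {R : realType} {mu : LSmeasure R}.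
Hypothesis mu_weight : fin_int mu setT (fun t => (1 + `|t|)^-1).
Implicit Types (f g : R -> R[i]) (u v : R -> R) (a c l : R[i]).

Local Notation measR u := (measurable_fun (setT : set (measurableTypeR R)) u).

(** * Integrability derived from the weight 1/(1+|t|) *)

Lemma measurable_abs1 : measR (fun t => 1 + `|t|).
Proof.
apply: measurable_funD; first exact: measurable_cst.
apply: measurableT_comp.
  exact: normr_measurable.
exact: measurable_id.
Qed.

Lemma measurable_sqr1 : measR (fun t => t ^+ 2 + 1).
Proof.
apply: measurable_funD; last exact: measurable_cst.
by apply: measurable_funX; exact: measurable_id.
Qed.

Lemma weight_integrable : mu.-integrable setT (EFin \o (fun t => (1 + `|t|)^-1)).
Proof.
have w0 (t : R) : 0 <= 1 + `|t| by rewrite addr_ge0.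
apply/fin_int_integrable => //; exact: measurable_inv_ge0 measurable_abs1.
Qed.

(** After multiplication by [1 + |t|] the left side is at most [|x| + |t x - k| + |k|], and
    [y <= y^2 + 1] for the first two terms produces the 2. With x and k the real or imaginary parts
    of f(t) and c, this dominates f by integrable functions. *)
Lemma le_weight_sum (t x k : R) :
  `|x| <= x ^+ 2 + (t * x - k) ^+ 2 + (2 + `|k|) * (1 + `|t|)^-1.
Proof.
have a0 : 0 < 1 + `|t| by rewrite ltr_pwDl.
rewrite -(ler_pM2r a0) mulrDl divfK ?lt0r_neq0//.
have tx : `|t| * `|x| <= `|t * x - k| + `|k|.
  by rewrite -normrM -[X in `|X| <= _](subrK k) ler_normD.
rewrite -(real_normK (num_real x)) -(real_normK (num_real (t * x - k))).
move: tx (normr_ge0 x) (normr_ge0 (t * x - k)) (normr_ge0 t).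
move: `|t| `|x| `|t * x - k| `|k| => T X U K tx X0 U0 T0.
have TXU : 0 <= (X ^+ 2 + U ^+ 2) * T by rewrite mulr_ge0// addr_ge0// sqr_ge0.
have X1 : X <= X ^+ 2 + 1 by nra.
have U1 : U <= U ^+ 2 + 1 by nra.
lra.
Qed.

Lemma dom_cintegrable f c : L2 mu f -> L2 mu (fun t => rC t * f t - c) ->
  cintegrable mu f.
Proof.
move=> /L2P[[f1 f2] If] /L2P[_ Iu].
have bound (k : R) : mu.-integrable setT (EFin \o (fun t : R =>
   (2 + `|k|) * (1 + `|t|)^-1 + (1 * csq (f t) + csq (rC t * f t - c)))).
  by apply: integrable_linear; [exact: weight_integrable|exact: integrable_linear].
split.
- apply: (integrable_le _ _ f1 _ (bound (complex.Re c))) => t.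
  apply: le_trans (le_weight_sum t _ (complex.Re c)) _.
  rewrite addrC lerD2l mul1r -Re_rCM -ReB.
  by rewrite lerD// /csq lerDl sqr_ge0.
- apply: (integrable_le _ _ f2 _ (bound (complex.Im c))) => t.
  apply: le_trans (le_weight_sum t _ (complex.Im c)) _.
  rewrite addrC lerD2l mul1r -Im_rCM -ImB.
  by rewrite lerD// /csq lerDr sqr_ge0.
Qed.

Lemma le_weight_integrable u : measR u ->
  (forall t, `|u t| <= 2 * (1 + `|t|)^-1) ->
  cintegrable mu (fun t => rC (u t)) /\ L2 mu (fun t => rC (u t)).
Proof.
move=> mesu uw; split.
  split; first exact: (integrable_le _ _ mesu uw (integrable_scale _ _ weight_integrable)).
  by apply: (integrable_le _ _ _ _ (integrable_scale 0 _ weight_integrable)) => [|t];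
    [exact: measurable_cst|rewrite /= mul0r normr0].
apply/L2P; split; first exact: cmeasurable_rC.
(* With w the weight, [u^2 <= 4 w^2 <= 4 w], because [w <= 1]. *)
apply: (integrable_le _ _ _ _ (integrable_scale 4 _ weight_integrable)).
  exact: (cmeasurable_csq _ (cmeasurable_rC _ mesu)).
move=> t; rewrite ger0_norm ?csq_ge0// csq_rC -real_normK ?num_real//.
have w1 : (1 + `|t|)^-1 <= 1 by rewrite invf_le1 ?ltr_pwDl// lerDl.
have w0 : 0 <= (1 + `|t|)^-1 by rewrite invr_ge0 addr_ge0.
have := uw t; have := normr_ge0 (u t).
move: (1 + `|t|)^-1 w1 w0 `|u t| => w w1 w0 U U0 Uw; nra.
Qed.

Lemma le_weight_of_inv (t x : R) : `|x| * (1 + `|t|) <= 2 * (t ^+ 2 + 1) ->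
  `|x / (t ^+ 2 + 1)| <= 2 * (1 + `|t|)^-1.
Proof.
have t0 : 0 < t ^+ 2 + 1 by rewrite ltr_wpDl ?sqr_ge0.
move=> H; rewrite normrM normfV (gtr0_norm t0) ler_pdivrMr// mulrAC.
by rewrite ler_pdivlMr ?ltr_pwDl.
Qed.

(** This function spans the domain of the adjoint modulo the domain of multiplication by t, and its
    integral is the constant in the boundary map; hence both kinds of integrability are wanted. *)
Lemma deficiency_elt : cintegrable mu (fun t => rC (t / (t ^+ 2 + 1))) /\
  L2 mu (fun t => rC (t / (t ^+ 2 + 1))).
Proof.
apply: le_weight_integrable => [|t].
  apply: measurable_funM; first exact: measurable_id.
  apply: measurable_inv_ge0 measurable_sqr1 => t.
  by rewrite addr_ge0 ?sqr_ge0.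
apply: le_weight_of_inv; rewrite -(real_normK (num_real t)).
move: `|t| (normr_ge0 t) => T T0; nra.
Qed.

Lemma L2_inv_sqr1 : L2 mu (fun t => rC (t ^+ 2 + 1)^-1).
Proof.
have [] // := le_weight_integrable (fun t => (t ^+ 2 + 1)^-1).
  apply: measurable_inv_ge0 measurable_sqr1 => t.
  by rewrite addr_ge0 ?sqr_ge0.
move=> t; rewrite -[X in `|X|]mul1r; apply: le_weight_of_inv.
rewrite normr1 -(real_normK (num_real t)).
move: `|t| (normr_ge0 t) => T T0; nra.
Qed.

(** * The point indicator, powers of the resolvent, and atoms *)

Lemma point_indE l t : rC t = l -> point_ind l t = 1.
Proof. by move=> tl; rewrite /point_ind indicE mem_set. Qed.

Lemma point_ind0 l t : rC t <> l -> point_ind l t = 0.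
Proof. by move=> tl; rewrite /point_ind indicE memNset. Qed.

Lemma resolvent_cancel l t : (rC t - l) * (rC t - l)^-1 = 1 - point_ind l t.
Proof.
have [tl|tl] := eqVneq (rC t) l.
  by rewrite tl subrr mul0r point_indE// subrr.
by rewrite mulfV ?subr_eq0// point_ind0 ?subr0//; apply/eqP.
Qed.

Lemma sub_point_ind l t : (rC t - l) * point_ind l t = 0.
Proof.
have [tl|/eqP tl] := eqVneq (rC t) l; first by rewrite tl subrr mul0r.
by rewrite point_ind0// mulr0.
Qed.

Lemma rpow_cancel l j t : (rC t - l) * rpow l j.+2 t = rpow l j.+1 t.
Proof.
rewrite /rpow; have [tl|tl] := eqVneq (rC t) l.
  by rewrite tl subrr mul0r exprS mul0r invr0.
by rewrite [_ ^+ j.+2]exprS invfM mulrA mulfV ?mul1r// subr_eq0.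
Qed.

Lemma rpow_point l j t : rC t = l -> rpow l j.+1 t = 0.
Proof. by move=> tl; rewrite /rpow tl subrr expr0n invr0. Qed.

Lemma rpow1 l t : rpow l 1 t = (rC t - l)^-1.
Proof. by []. Qed.

Lemma rpowS l j t : rpow l j.+1 t = rpow l j t * (rC t - l)^-1.
Proof. by rewrite /rpow exprSr invfM. Qed.

Lemma cmeasurable_rpow l j : cmeasurable (rpow l j).
Proof.
rewrite /rpow; under eq_fun => t do rewrite -exprVn.
exact/cmeasurableX/cmeasurable_resolvent.
Qed.

Lemma L2_rpow l j :
  L2 mu (rpow l j) <-> fin_int mu setT (fun t => (csq (rC t - l) ^+ j)^-1).
Proof.
rewrite /L2 /fin_int.
have -> : (fun t : R => (csq (rpow l j t))%:E) =
          (fun t => ((csq (rC t - l) ^+ j)^-1)%:E).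
  by apply/funext => t; rewrite csqV csqX.
by split=> [[]|] //; split=> //; exact: cmeasurable_rpow.
Qed.

Lemma measurable_point_ind l :
  measR (\1_[set t : R | rC t = l] : R -> R).
Proof. by apply: measurable_indic; exact: measurable_real_point. Qed.

Lemma integrable_point_ind l :
  mu.-integrable setT (EFin \o (\1_[set t : R | rC t = l] : R -> R)).
Proof.
(* The factor is chosen so that the scaled weight equals 1 at [l]. *)
apply: (integrable_le _ _ (measurable_point_ind l) _
  (integrable_scale (1 + `|complex.Re l|) _ weight_integrable)) => t.
have a0 (s : R) : 0 < 1 + `|s| by rewrite ltr_pwDl.
have [tl|tl] := pselect (rC t = l).
  by rewrite indicE mem_set//= normr1 -tl/= mulfV ?lt0r_neq0.
by rewrite indicE memNset//= normr0 mulr_ge0// ?invr_ge0 ltW.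
Qed.

Lemma point_mass_fin l : (mu [set t : R | rC t = l] < +oo)%E.
Proof.
have /integrableP[_] := integrable_point_ind l.
under eq_integral => t _ do rewrite /= ger0_norm//.
rewrite integral_indic ?setIT//; exact: measurable_real_point.
Qed.

Lemma cintegrable_point_ind l : cintegrable mu (point_ind l).
Proof.
split; first exact: integrable_point_ind.
by apply: (integrable_le _ _ _ _ (integrable_point_ind l)) => [|t];
  [exact: measurable_cst|rewrite /= normr0].
Qed.

Lemma cint_point_ind l :
  cint mu setT (point_ind l) = rC (fine (mu [set t : R | rC t = l])).
Proof.
rewrite /cint /point_ind /rC /= Rintegral_cst// mul0r; congr Complex.
rewrite /Rintegral integral_indic ?setIT//; exact: measurable_real_point.
Qed.

Lemma L2_point_ind l : L2 mu (point_ind l).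
Proof.
apply/L2P; split; first by apply: cmeasurable_rC; exact: measurable_point_ind.
rewrite (_ : (fun t => _) = (\1_[set t : R | rC t = l] : R -> R)).
  exact: integrable_point_ind.
apply/funext => t; rewrite csq_rC indicE; case: (_ \in _) => /=;
  by rewrite ?expr1n ?expr0n.
Qed.

Lemma ae_point_ind0 l a : mu [set t : R | rC t = l] = 0%E ->
  ae_eq mu (fun t => a * point_ind l t) (fun=> 0).
Proof.
move=> mul0; have neg : mu.-negligible [set t : R | rC t = l].
  by apply/negligibleP => //; exact: measurable_real_point.
by apply: negligibleS neg => t /=; apply: contra_notP => tl; rewrite point_ind0// mulr0.
Qed.

(** An atom is not negligible, so an almost everywhere equality becomes a genuine equality there. *)
Lemma ae_at_point l f g : mu [set t : R | rC t = l] <> 0%E -> ae_eq mu f g ->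
  exists2 t : R, rC t = l & f t = g t.
Proof.
move=> mul0 fg; apply: contrapT => nex; apply: mul0.
apply/negligibleP; first exact: measurable_real_point.
by apply: negligibleS fg => t /= tl fgt; apply: nex; exists t.
Qed.

(** An eigenfunction of multiplication by t vanishes almost everywhere off [l], so it can be nonzero
    only if [l] is an atom, and then the indicator is one. *)
Lemma sigma_p_QP l : sigma_p_Q mu l <-> mu [set t : R | rC t = l] <> 0%E.
Proof.
split=> [[f [_ [nf0 ft]]] mul0|mul0].
  apply/nf0/(ae_imp2 ft (ae_point_ind0 l 1 mul0)) => t tl /eqP.
  rewrite mul1r; have [tnl|/negPf tnl] := eqVneq (rC t) l.
    by rewrite point_indE// oner_eq0.
  move=> _; apply/eqP; move/eqP: tl; rewrite -subr_eq0 -mulrBl mulf_eq0.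
  by rewrite subr_eq0 tnl.
exists (point_ind l); split; last split.
- split; first exact: L2_point_ind.
  rewrite (_ : (fun t => _) = (fun t => l * point_ind l t)).
    exact/L2_scale/L2_point_ind.
  by apply/funext => t; apply/eqP; rewrite -subr_eq0 -mulrBl sub_point_ind.
- move=> /(ae_at_point _ _ _ mul0)[t tl]; rewrite point_indE// => /eqP.
  by rewrite oner_eq0.
- rewrite (_ : (fun t => rC t * _) = (fun t => l * point_ind l t)); first exact: ae_refl.
  by apply/funext => t; apply/eqP; rewrite -subr_eq0 -mulrBl sub_point_ind.
Qed.

(** * Solving the one-component equation *)

Lemma eqn_comp_intro l c f g : L2 mu f -> L2 mu g ->
  (forall t, (rC t - l) * f t = g t + c) -> eqn_comp mu l c f g.
Proof.
move=> Lf Lg fg; split=> //; last by under eq_fun => t do rewrite fg; exact: ae_refl.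
(* The domain condition comes for free: the equation gives [t f - c = l f + g], a sum of two
   elements of L^2. *)
rewrite (_ : (fun t => _) = (fun t => l * f t + g t)); first exact: L2_linear.
by apply/funext => t; rewrite -[g t](addrK c) -fg; ring.
Qed.

Lemma eqn_comp_ae l c f f' g g' : eqn_comp mu l c f g -> cmeasurable f' ->
  ae_eq mu f f' -> ae_eq mu g g' -> eqn_comp mu l c f' g'.
Proof.
move=> [Lf Ltf fg] mf' ff' gg'; split; first exact: L2_ae Lf mf' ff'.
  apply: (L2_ae _ _ Ltf); last by apply: (ae_imp ff') => t ->.
  apply: cmeasurableD (cmeasurable_cst _); apply: cmeasurableM mf'.
  by apply: cmeasurable_rC; exact: measurable_id.
have fg' : ae_eq mu (fun t => (rC t - l) * f' t) (fun t => g t + c).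
  by apply: (ae_imp2 fg ff') => t + <-.
by apply: (ae_imp2 fg' gg') => t + <-.
Qed.

Lemma eqn_comp_linear l a c f g c' f' g' :
  eqn_comp mu l c f g -> eqn_comp mu l c' f' g' ->
  eqn_comp mu l (a * c + c') (fun t => a * f t + f' t) (fun t => a * g t + g' t).
Proof.
move=> [Lf Ltf fg] [Lf' Ltf' fg']; split; first exact: L2_linear.
  rewrite (_ : (fun t => _) = (fun t => a * (rC t * f t - c) + (rC t * f' t - c'))).
    exact: L2_linear.
  by apply/funext => t; ring.
apply: (ae_imp2 fg fg') => t ft ft'.
have -> : (rC t - l) * (a * f t + f' t) = a * ((rC t - l) * f t) + (rC t - l) * f' t by ring.
by rewrite ft ft'; ring.
Qed.

Lemma eqn_comp_cintegrable l c f g : eqn_comp mu l c f g -> cintegrable mu f.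
Proof. by move=> [Lf Ltf _]; exact: dom_cintegrable Lf Ltf. Qed.

Lemma eqn_comp_sol l c f g : eqn_comp mu l c f g -> exists a,
  ae_eq mu f (fun t => (g t + c) * (rC t - l)^-1 + a * point_ind l t).
Proof.
(* At [l] the equation leaves f free, so the coefficient is the value of f there; for nonreal [l]
   the indicator is zero and any coefficient would do. *)
move=> [_ _ fg]; exists (f (complex.Re l)); apply: (ae_imp fg) => t /=.
have [tl|/eqP tl] := eqVneq (rC t) l.
  rewrite tl subrr mul0r invr0 mulr0 add0r point_indE// mulr1 => _.
  by rewrite -tl.
move=> <-; rewrite point_ind0// mulr0 addr0 mulrAC mulfV ?mul1r//.
by rewrite subr_eq0; apply/eqP.
Qed.

(** The factor [t - l] kills the left side at the atom. Every obstruction to extending a chain at a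
    charged point comes from this evaluation. *)
Lemma eqn_comp_at_point l c f g : mu [set t : R | rC t = l] <> 0%E ->
  eqn_comp mu l c f g -> exists2 t : R, rC t = l & g t = - c.
Proof.
move=> mul0 [_ _ /(ae_at_point _ _ _ mul0)[t tl]].
rewrite tl subrr mul0r => gc; exists t => //.
by apply/eqP; rewrite -addr_eq0 -gc.
Qed.

Lemma eqn_comp_rpow l j : L2 mu (rpow l j.+1) -> L2 mu (rpow l j.+2) ->
  eqn_comp mu l 0 (rpow l j.+2) (rpow l j.+1).
Proof. by move=> L1 L2'; apply: eqn_comp_intro => // t; rewrite addr0 rpow_cancel. Qed.

(** Since [0^-1 = 0], the product [(t - l) (t - l)^-1] is 1 except at [l], where it is 0. The defect
    is null when [l] carries no mass, making the resolvent a kernel element; otherwise it is the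
    vector that precedes the resolvent in the chain. *)
Lemma eqn_comp_rpow1 l : L2 mu (rpow l 1) ->
  eqn_comp mu l 1 (rpow l 1) (fun t => - point_ind l t).
Proof.
move=> L1; apply: eqn_comp_intro => // [|t]; last by rewrite rpow1 resolvent_cancel addrC.
by under eq_fun => t do rewrite -mulN1r; exact/L2_scale/L2_point_ind.
Qed.

Lemma eqn_comp_point_ind l a : eqn_comp mu l 0 (fun t => a * point_ind l t) (fun=> 0).
Proof.
apply: eqn_comp_intro => [||t]; [exact/L2_scale/L2_point_ind|exact: L2_0|].
by rewrite mulrCA sub_point_ind mulr0 addr0.
Qed.

(** * Removing the decomposition and the boundary maps *)

Lemma t_deficiency_elt (t : R) :
  rC t * rC (t / (t ^+ 2 + 1)) = 1 - rC (t ^+ 2 + 1)^-1.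
Proof.
have t0 : t ^+ 2 + 1 != 0 :> R by rewrite lt0r_neq0// ltr_wpDl ?sqr_ge0.
by apply/eqP; rewrite eq_complex /=; apply/andP; split; apply/eqP; [field|ring].
Qed.

Lemma Tdecomp_eqn_comp (C : R) l c f fQ g :
  C = Rintegral mu setT (fun t => t / (1 + t ^+ 2)) ->
  L2 mu f -> Tdecomp mu f fQ c ->
  ae_eq mu (fun t => l * f t + g t) (Tval fQ c) ->
  eqn_comp mu l c f g /\ Gamma1 mu C fQ c = cint mu setT f.
Proof.
move=> -> Lf [[LfQ LtfQ] fE] gE.
have [Is Ls] := deficiency_elt; have Lv := L2_inv_sqr1.
(* Multiplying [c t/(t^2+1)] by t gives [c - c/(t^2+1)], so the fractions cancel and only the
   constant remains. *)
have tfE : ae_eq mu (Tval fQ c) (fun t => rC t * f t - c).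
  by apply: (ae_imp fE) => t ->; rewrite /Tval mulrDr mulrCA t_deficiency_elt; ring.
have mtf : cmeasurable (fun t => rC t * f t - c).
  apply: cmeasurableD (cmeasurable_cst _); apply: cmeasurableM Lf.1.
  by apply: cmeasurable_rC; exact: measurable_id.
split.
  split=> //.
    apply: L2_ae mtf tfE; rewrite (_ : Tval fQ c =
      (fun t => (- c) * rC (t ^+ 2 + 1)^-1 + rC t * fQ t)); first exact: L2_linear.
    by apply/funext => t; rewrite /Tval; ring.
  apply: (ae_imp2 gE tfE) => t gt; rewrite -gt => H.
  have -> : g t = rC t * f t - c - l * f t by rewrite -H; ring.
  ring.
have IfQ : cintegrable mu fQ.
  apply: (dom_cintegrable _ 0 LfQ); under eq_fun => t do rewrite subr0.
  exact: LtfQ.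
rewrite (cint_ae _ _ Lf.1 _ fE); last first.
  apply: cmeasurableD LfQ.1 _; apply: cmeasurableM (cmeasurable_cst _) Ls.1.
rewrite cintD ?cintZ//; last exact: cintegrableZ.
rewrite /Gamma1 addrC; congr (_ + c * _).
rewrite /cint /rC /= Rintegral_cst// mul0r; congr Complex.
by apply: eq_Rintegral => t _; rewrite addrC.
Qed.

Lemma eqn_comp_Tdecomp (C : R) l c f g :
  C = Rintegral mu setT (fun t => t / (1 + t ^+ 2)) ->
  eqn_comp mu l c f g -> exists2 fQ, Tdecomp mu f fQ c &
  ae_eq mu (fun t => l * f t + g t) (Tval fQ c) /\ Gamma1 mu C fQ c = cint mu setT f.
Proof.
move=> CE [Lf Ltf fg]; have [Is Ls] := deficiency_elt; have Lv := L2_inv_sqr1.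
pose fQ t := f t - c * rC (t / (t ^+ 2 + 1)).
have tfQ t : rC t * fQ t = c * rC (t ^+ 2 + 1)^-1 + (rC t * f t - c).
  by rewrite mulrBr mulrCA t_deficiency_elt; ring.
have dfQ : Tdecomp mu f fQ c.
  split; last first.
    by rewrite (_ : (fun t => _) = f); [exact: ae_refl|apply/funext => t; rewrite subrK].
  split; last by under eq_fun => t do rewrite tfQ; exact: L2_linear.
  rewrite (_ : fQ = fun t => (- c) * rC (t / (t ^+ 2 + 1)) + f t); first exact: L2_linear.
  by apply/funext => t; rewrite /fQ; ring.
have gE : ae_eq mu (fun t => l * f t + g t) (Tval fQ c).
  apply: (ae_imp fg) => t ft; rewrite /Tval tfQ.
  have -> : g t = (rC t - l) * f t - c by rewrite ft addrK.
  ring.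
exists fQ => //; split=> //.
by have [] := Tdecomp_eqn_comp _ _ _ _ _ _ CE Lf dfQ gE.
Qed.

End Component.

(** * Algebraic multiplicity from a maximal chain *)

Section VectorIndependence.
Context {R : realType} {Z : vec R -> Prop}.
Hypotheses (Z0 : Z 0) (Zlin : forall (a : R[i]) (f g : vec R), Z f -> Z g -> Z (a *: f + g)).

Lemma vec_sumE n (a : 'I_n -> R[i]) (v : 'I_n -> vec R) :
  (fun t => \sum_(i < n) a i * (v i).1 t, fun t => \sum_(i < n) a i * (v i).2 t) =
  \sum_(i < n) a i *: v i :> vec R.
Proof.
elim: n a v => [|n IHn] a v.
  by rewrite big_ord0; congr pair; apply/funext => t; rewrite big_ord0.
rewrite big_ord_recl -IHn; congr pair; apply/funext => t; by rewrite big_ord_recl.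
Qed.

Lemma span_not_indep (S : vec R -> Prop) (f : nat -> vec R) k :
  (forall h, S h -> exists a : 'I_k -> R[i], Z (h - \sum_i a i *: f i)) ->
  ~ has_indep Z S k.+1.
Proof.
move=> span [v [Sv]].
have [a [Za [i /eqP ai]]] := span_dependent Z0 Zlin f k v (fun i => span _ (Sv i)).
by move=> /(_ a); rewrite vec_sumE => /(_ Za)/(_ i).
Qed.

End VectorIndependence.

Section GreatestChain.
Context {R : realType} {Z : vec R -> Prop} {A : vec R -> vec R -> Prop} {l : R[i]}
  {B : vec R -> vec R -> Prop}.
Hypotheses (Z0 : Z 0) (Zlin : forall (a : R[i]) (f g : vec R), Z f -> Z g -> Z (a *: f + g)).
Hypotheses (B0 : B 0 0)
  (Blin : forall (a : R[i]) (f g f' g' : vec R),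
     B f f' -> B g g' -> B (a *: f + g) (a *: f' + g')).
Hypotheses (BZ : forall f g g' : vec R, B f g -> Z (g' - g) -> B f g')
  (Bfun : forall f g, Z f -> B f g -> Z g).
Hypothesis BE : forall f g, A f (vadd (vscale l f) g) <-> B f g.

Lemma root_nE n f : root_n Z A l n f <-> rel_ker_pow (Z := Z) (B := B) n f.
Proof.
elim: n f => [//|n IHn] f /=.
by split=> -[g [/IHn rg /BE Bg]]; exists g.
Qed.

Variables (f : nat -> vec R).
Hypotheses (Zf0 : ~ Z (f 0%N)) (Bf0 : B (f 0%N) 0).

Lemma eigenvector_point_spec : point_spec Z A l.
Proof. by exists (f 0%N); split=> //; apply/root_nE; exists 0. Qed.

Lemma chain_has_indep (S : vec R -> Prop) k :
  (forall i, (i.+1 < k)%N -> B (f i.+1) (f i)) -> (forall i, (i < k)%N -> S (f i)) ->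
  has_indep Z S k.
Proof.
move=> Bf Sf; exists (fun i : 'I_k => f i); split=> [i|a]; first exact: Sf.
rewrite vec_sumE => Za i.
pose b j := if insub j is Some i' then a i' else 0.
have bE (j : 'I_k) : b j = a j by rewrite /b valK.
rewrite -bE; apply: (chain_free Z0 Zlin B0 Blin Bfun f k b) => //.
by under eq_bigr => j _ do rewrite bE.
Qed.

Lemma chain_alg_indep k : (forall i, (i.+1 < k)%N -> B (f i.+1) (f i)) ->
  has_indep Z (fun h => exists n, root_n Z A l n h) k.
Proof.
move=> Bf; apply: chain_has_indep => // i ik; exists i.+1; apply/root_nE.
exact: chain_mem_ker_pow ik.
Qed.

Hypothesis kerB : forall h, rel_ker_pow (Z := Z) (B := B) 1 h ->
  exists a : R[i], Z (h - a *: f 0%N).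

Lemma eigenline_geom_mult : geom_mult Z A l (Some 1%N).
Proof.
split.
  by apply: chain_has_indep => -[|]// _; apply/root_nE; exists 0.
apply: (span_not_indep Z0 Zlin _ f) => h /root_nE /kerB[a Za].
by exists (fun=> a); rewrite big_ord1.
Qed.

Lemma maximal_chain_alg_mult k : (forall i, (i.+1 < k.+1)%N -> B (f i.+1) (f i)) ->
  (forall h, ~ B h (f k)) -> alg_mult Z A l (Some k.+1).
Proof.
move=> Bf fmax; split; first exact: chain_alg_indep.
apply: (span_not_indep Z0 Zlin _ f) => h [n /root_nE].
exact: maximal_chain_spans.
Qed.

(** [E i] says that [f i.+1] may be appended, which makes a chain of i + 2 vectors; hence [i.+2] in
    the link with [Q]. If [E] always holds, there are independent chains of every length. Otherwise
    the least failing index k leaves [f k] without preimage, and the root subspace has dimension k +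
    1. The first hypothesis guarantees that k + 1 is at least [lo]. *)
Lemma greatest_chain_alg_mult (lo : nat) (E : nat -> Prop) (Q : option nat -> Prop) :
  (forall i, (i.+1 < lo)%N -> E i) ->
  (forall m, ge_lo lo m -> Q m <-> forall i, jle i.+2 m -> E i) ->
  (forall i, (forall j, (j <= i)%N -> E j) -> B (f i.+1) (f i)) ->
  (forall i h, (forall j, (j < i)%N -> E j) -> B h (f i) -> E i) ->
  exists m, greatest_from lo Q m /\ alg_mult Z A l m.
Proof.
move=> Elo QE EB BE'; have [Eall|/existsNP[k0 Ek0]] := pselect (forall i, E i).
  exists None; split; last by move=> k; apply: chain_alg_indep => i _; exact: EB.
  by do 2?[split] => //; apply/QE.
have exk : exists k, ~~ `[< E k >] by exists k0; apply/asboolPn.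
pose k := ex_minn exk.
have Enk : ~ E k by rewrite /k; case: ex_minnP => ? /asboolPn.
have Eltk i : (i < k)%N -> E i.
  rewrite /k; case: ex_minnP => n _ minn ltin; apply: contrapT => nEi.
  by move: ltin; rewrite ltnNge minn//; apply/asboolPn.
have lok : (lo <= k.+1)%N.
  by rewrite leqNgt; apply/negP => /Elo.
exists (Some k.+1); split; last first.
  apply: maximal_chain_alg_mult => [i ik|h /BE'].
    by apply: EB => j ji; apply: Eltk; apply: leq_ltn_trans ji _.
  by move=> /(_ Eltk).
have gelo : ge_lo lo (Some k.+1) by move=> _ [<-].
split=> //; split; first by apply/QE => // i; exact: Eltk.
move=> [k'|] lo' /QE Qm'; last by apply/Enk/Qm'.
rewrite /= leqNgt; apply/negP => ltk; apply/Enk/Qm' => //.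
Qed.

End GreatestChain.

(** * The coupled equation *)

Section Coupling.
Context {R : realType} {mup mum : LSmeasure R}.
Hypotheses (wp : fin_int mup setT (fun t => (1 + `|t|)^-1))
           (wm : fin_int mum setT (fun t => (1 + `|t|)^-1)).
Hypotheses (mupT : mup setT = +oo%E) (mumT : mum setT = +oo%E).
Implicit Types (f g h : vec R) (l a c : R[i]).

Local Notation Z := (vzero mup mum).
Local Notation E l := [set t : R | rC t = l].

Definition ahat_eqn l f g : Prop := exists c,
  [/\ eqn_comp mup l c f.1 g.1, eqn_comp mum l c f.2 g.2 &
      cint mup setT f.1 = cint mum setT f.2].

Lemma Ahat_eqnP (Cp Cm : R) l f g :
  Cp = Rintegral mup setT (fun t => t / (1 + t ^+ 2)) ->
  Cm = Rintegral mum setT (fun t => t / (1 + t ^+ 2)) ->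
  Ahat_graph mup Cp mum Cm f (vadd (vscale l f) g) <-> ahat_eqn l f g.
Proof.
move=> CpE CmE; split.
  move=> [L1 [L2' [fQp [c [fQm [c' [T1 [T2 [cc' [G [g1 g2]]]]]]]]]]].
  subst c'.
  have [c1 G1] := Tdecomp_eqn_comp wp Cp l c _ _ _ CpE L1 T1 g1.
  have [c2 G2] := Tdecomp_eqn_comp wm Cm l c _ _ _ CmE L2' T2 g2.
  by exists c; split=> //; rewrite -G1 G.
move=> [c [c1 c2 I]].
have [fQp T1 [g1 G1]] := eqn_comp_Tdecomp wp Cp l c _ _ CpE c1.
have [fQm T2 [g2 G2]] := eqn_comp_Tdecomp wm Cm l c _ _ CmE c2.
split; first by case: c1.
split; first by case: c2.
by exists fQp, c, fQm, c; rewrite G1 G2; split=> //; split=> //; split.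
Qed.

Lemma vzero0 : Z 0.
Proof. by split; exact: ae_refl. Qed.

Lemma vzero_linear a f g : Z f -> Z g -> Z (a *: f + g).
Proof.
by move=> [f1 f2] [g1 g2]; split;
  [apply: (ae_imp2 f1 g1)|apply: (ae_imp2 f2 g2)] => t ft gt;
  rewrite -[LHS]/(a * _ + _) ft gt mulr0 addr0.
Qed.

Lemma ahat_eqn0 l : ahat_eqn l 0 0.
Proof.
have e0 (mu : LSmeasure R) : eqn_comp mu l 0 (fun=> 0) (fun=> 0).
  by apply: eqn_comp_intro => [||t]; rewrite ?mulr0 ?addr0//; exact: L2_0.
by exists 0; split; rewrite /cint/= ?Rintegral_cst ?mul0r//; exact: e0.
Qed.

Lemma ahat_eqn_linear l a f g f' g' :
  ahat_eqn l f f' -> ahat_eqn l g g' -> ahat_eqn l (a *: f + g) (a *: f' + g').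
Proof.
move=> [c [f1 f2 fI]] [d [g1 g2 gI]]; exists (a * c + d).
split; [exact: eqn_comp_linear|exact: eqn_comp_linear|].
have [F1 F2] := (eqn_comp_cintegrable wp _ _ _ _ f1, eqn_comp_cintegrable wm _ _ _ _ f2).
have [G1 G2] := (eqn_comp_cintegrable wp _ _ _ _ g1, eqn_comp_cintegrable wm _ _ _ _ g2).
rewrite [LHS](cintD (fun t => a * f.1 t) g.1)// ?[RHS](cintD (fun t => a * f.2 t) g.2)//;
  try exact: cintegrableZ.
by rewrite !cintZ// fI gI.
Qed.

Lemma ahat_eqn_vzero l f g g' : ahat_eqn l f g -> Z (g' - g) -> ahat_eqn l f g'.
Proof.
move=> [c [f1 f2 fI]] [z1 z2]; exists c; split=> //.
- apply: (eqn_comp_ae _ _ _ _ _ _ f1) (ae_refl _) _; first by case: f1 => -[].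
  by apply: (ae_imp z1) => t /subr0_eq.
- apply: (eqn_comp_ae _ _ _ _ _ _ f2) (ae_refl _) _; first by case: f2 => -[].
  by apply: (ae_imp z2) => t /subr0_eq.
Qed.

(* Infinite total mass excludes the nonzero constants from L^2. *)
Lemma eqn_comp_null (mu : LSmeasure R) l c (f g : R -> R[i]) : mu setT = +oo%E ->
  ae_zero mu f -> eqn_comp mu l c f g -> c = 0 /\ ae_zero mu g.
Proof.
move=> muT f0 [_ Ltf fg]; have c0 : c = 0.
  apply/eqP; rewrite -oppr_eq0; apply/eqP/(L2_cst_eq0 _ muT).
  apply: (L2_ae _ _ Ltf (cmeasurable_cst _)).
  by apply: (ae_imp f0) => t ->; rewrite mulr0 sub0r.
split=> //; apply: (ae_imp2 f0 fg) => t ->.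
by rewrite mulr0 c0 addr0 => <-.
Qed.

Lemma ahat_eqn_functional l f g : Z f -> ahat_eqn l f g -> Z g.
Proof.
move=> [f1 f2] [c [c1 c2 _]]; split.
- by have [] := eqn_comp_null _ _ _ _ _ mupT f1 c1.
- by have [] := eqn_comp_null _ _ _ _ _ mumT f2 c2.
Qed.

Lemma ahat_eqn_kernel l f : rel_ker_pow (Z := Z) (B := ahat_eqn l) 1 f -> exists c a b,
  [/\ eqn_comp mup l c f.1 (fun=> 0), eqn_comp mum l c f.2 (fun=> 0),
      cint mup setT f.1 = cint mum setT f.2,
      ae_eq mup f.1 (fun t => c * rpow l 1 t + a * point_ind l t) &
      ae_eq mum f.2 (fun t => c * rpow l 1 t + b * point_ind l t)].
Proof.
move=> [g [[g1 g2] [c [c1 c2 I]]]].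
have m1 : cmeasurable f.1 by case: c1 => -[].
have m2 : cmeasurable f.2 by case: c2 => -[].
have {}c1 := eqn_comp_ae _ _ _ _ _ _ c1 m1 (ae_refl _) g1.
have {}c2 := eqn_comp_ae _ _ _ _ _ _ c2 m2 (ae_refl _) g2.
have [a fa] := eqn_comp_sol _ _ _ _ c1; have [b fb] := eqn_comp_sol _ _ _ _ c2.
exists c, a, b; split=> //.
- by apply: (ae_imp fa) => t ->; rewrite add0r.
- by apply: (ae_imp fb) => t ->; rewrite add0r.
Qed.

(* A summand without mass at [l] forces the other one, supported at [l], to
   have integral zero. *)
Lemma point_supported_null (mu nu : LSmeasure R) (f1 f2 : R -> R[i]) l a b :
  fin_int nu setT (fun t => (1 + `|t|)^-1) ->
  cmeasurable f1 -> cmeasurable f2 ->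
  cint mu setT f1 = cint nu setT f2 ->
  ae_eq mu f1 (fun t => a * point_ind l t) ->
  ae_eq nu f2 (fun t => b * point_ind l t) ->
  mu (E l) = 0%E -> ae_zero mu f1 /\ ae_zero nu f2.
Proof.
move=> wn m1 m2 I f1E f2E mu0.
have f10 : ae_zero mu f1 by apply: (ae_imp2 f1E (ae_point_ind0 l a mu0)) => t -> ->.
split=> //.
have [nu0|nu0] := pselect (nu (E l) = 0%E).
  by apply: (ae_imp2 f2E (ae_point_ind0 l b nu0)) => t -> ->.
have mb : cmeasurable (fun t => b * point_ind l t).
  by apply: cmeasurableM (cmeasurable_cst _) _; apply: cmeasurable_rC; exact: measurable_point_ind.
move: I; rewrite (cint_ae _ _ m1 (cmeasurable_cst 0) f10) (cint_ae _ _ m2 mb f2E).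
rewrite cintZ ?cint_point_ind//; last exact: cintegrable_point_ind.
rewrite {1}/cint /= Rintegral_cst// mul0r => /esym/eqP; rewrite mulf_eq0 => /orP[/eqP b0|/eqP].
  by apply: (ae_imp f2E) => t ->; rewrite b0 mul0r.
move=> /(congr1 (@complex.Re R))/= fn0; exfalso; apply: nu0.
by rewrite -[LHS]fineK ?fn0// ge0_fin_numE// point_mass_fin.
Qed.

Lemma eqn_comp_mass (mu : LSmeasure R) (f1 : R -> R[i]) l c :
  mu (E l) <> 0%E -> eqn_comp mu l c f1 (fun=> 0) -> c = 0.
Proof.
by move=> mul /(eqn_comp_at_point _ _ _ _ mul)[t _ /esym/eqP]; rewrite oppr_eq0 => /eqP.
Qed.

Lemma eqn_comp_sol_nomass (mu : LSmeasure R) (f1 : R -> R[i]) l c a :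
  mu (E l) = 0%E -> ae_eq mu f1 (fun t => c * rpow l 1 t + a * point_ind l t) ->
  ae_eq mu f1 (fun t => c * rpow l 1 t).
Proof.
by move=> mu0 f1E; apply: (ae_imp2 f1E (ae_point_ind0 l a mu0)) => t -> ->; rewrite addr0.
Qed.

Lemma L2_rpow1_of_multiple (mu : LSmeasure R) (f1 : R -> R[i]) l c a :
  fin_int mu setT (fun t => (1 + `|t|)^-1) -> c != 0 -> L2 mu f1 ->
  ae_eq mu f1 (fun t => c * rpow l 1 t + a * point_ind l t) -> L2 mu (rpow l 1).
Proof.
move=> w c0 Lf f1E; have Li := L2_point_ind w l.
apply: (L2_ae _ _ (L2_scale c^-1 _ (L2_linear (- a) _ _ Li Lf))); first exact: cmeasurable_rpow.
by apply: (ae_imp f1E) => t ->; field.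
Qed.

Lemma invsq_L2 (mu : LSmeasure R) l : fin_int mu setT (invsq l) <-> L2 mu (rpow l 1).
Proof.
rewrite L2_rpow; rewrite /invsq /fin_int.
by under [X in _ <-> (integral _ _ X < _)%E]eq_fun => t do rewrite expr1.
Qed.

(** With c = 0 both components live on [l], and a side without mass there forces the other to have
    integral zero, hence to be null. Parts 1 and 4 differ only in why c vanishes. *)
Lemma no_eigenvalue l :
  (forall f c a b, eqn_comp mup l c f.1 (fun=> 0) -> eqn_comp mum l c f.2 (fun=> 0) ->
     ae_eq mup f.1 (fun t => c * rpow l 1 t + a * point_ind l t) ->
     ae_eq mum f.2 (fun t => c * rpow l 1 t + b * point_ind l t) -> c = 0) ->
  mup (E l) = 0%E \/ mum (E l) = 0%E ->
  forall f, rel_ker_pow (Z := Z) (B := ahat_eqn l) 1 f -> Z f.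
Proof.
move=> c0 nomass f /ahat_eqn_kernel[c [a [b [c1 c2 I fa fb]]]].
have {c0}c0 : c = 0 := c0 _ _ _ _ c1 c2 fa fb.
have m1 : cmeasurable f.1 by case: c1 => -[].
have m2 : cmeasurable f.2 by case: c2 => -[].
have {}fa : ae_eq mup f.1 (fun t => a * point_ind l t).
  by apply: (ae_imp fa) => t ->; rewrite c0 mul0r add0r.
have {}fb : ae_eq mum f.2 (fun t => b * point_ind l t).
  by apply: (ae_imp fb) => t ->; rewrite c0 mul0r add0r.
case: nomass => [mu0|mu0].
  exact: point_supported_null wm m1 m2 I fa fb mu0.
by have [] := point_supported_null _ _ _ _ _ _ _ wp m2 m1 (esym I) fb fa mu0.
Qed.

(** * Chains at a point charged by neither measure *)

Definition reg_chain l (i : nat) : vec R := (rpow l i.+1, rpow l i.+1).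

Lemma reg_chain0 l : mup (E l) = 0%E -> mum (E l) = 0%E ->
  L2 mup (rpow l 1) -> L2 mum (rpow l 1) ->
  cint mup setT (rpow l 1) = cint mum setT (rpow l 1) -> ahat_eqn l (reg_chain l 0) 0.
Proof.
move=> p0 m0 Lp Lm I; exists 1; split=> //.
- apply: (eqn_comp_ae _ _ _ _ _ _ (eqn_comp_rpow1 wp l Lp) (cmeasurable_rpow _ _) (ae_refl _)).
  by apply: (ae_imp (ae_point_ind0 l 1 p0)) => t; rewrite mul1r => ->; rewrite oppr0.
- apply: (eqn_comp_ae _ _ _ _ _ _ (eqn_comp_rpow1 wm l Lm) (cmeasurable_rpow _ _) (ae_refl _)).
  by apply: (ae_imp (ae_point_ind0 l 1 m0)) => t; rewrite mul1r => ->; rewrite oppr0.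
Qed.

Lemma reg_chain0_nonzero l : eqn_comp mup l 1 (rpow l 1) (fun=> 0) -> ~ Z (reg_chain l 0).
Proof.
by move=> c1 [/= r0 _]; have [/eqP] := eqn_comp_null _ _ _ _ _ mupT r0 c1; rewrite oner_eq0.
Qed.

Lemma reg_chain_step l i :
  L2 mup (rpow l i.+1) -> L2 mum (rpow l i.+1) ->
  L2 mup (rpow l i.+2) -> L2 mum (rpow l i.+2) ->
  cint mum setT (rpow l i.+2) = cint mup setT (rpow l i.+2) ->
  ahat_eqn l (reg_chain l i.+1) (reg_chain l i).
Proof. by move=> Lp Lm Lp' Lm' I; exists 0; split=> //; exact: eqn_comp_rpow. Qed.

(** Without mass at [l] the general solution is the next power plus c times the resolvent.
    Subtracting that multiple of the eigenvector isolates the power; since the eigenvector has equal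
    integrals on both sides, the unknown c does not disturb their comparison. *)
Lemma reg_ext_comp (mu : LSmeasure R) l c i (h : R -> R[i]) :
  fin_int mu setT (fun t => (1 + `|t|)^-1) -> mu (E l) = 0%E ->
  L2 mu (rpow l 1) -> eqn_comp mu l c h (rpow l i.+1) ->
  L2 mu (rpow l i.+2) /\
  cint mu setT (rpow l i.+2) = cint mu setT h - c * cint mu setT (rpow l 1).
Proof.
move=> w mu0 L1 ch; have [a ha] := eqn_comp_sol _ _ _ _ ch.
have mh : L2 mu h by case: ch.
have hE : ae_eq mu (fun t => (- c) * rpow l 1 t + h t) (rpow l i.+2).
  apply: (ae_imp2 ha (ae_point_ind0 l a mu0)) => t -> ->.
  by rewrite addr0 mulrDl (rpowS _ i.+1) rpow1; ring.
have mr : cmeasurable (rpow l i.+2) by exact: cmeasurable_rpow.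
have Ls := L2_linear (- c) _ _ L1 mh.
split; first exact: L2_ae Ls mr hE.
have I1 := eqn_comp_cintegrable w _ _ _ _ (eqn_comp_rpow1 w l L1).
have Ih := eqn_comp_cintegrable w _ _ _ _ ch.
rewrite -(cint_ae _ _ Ls.1 mr hE) cintD ?cintZ//; last exact: cintegrableZ.
by rewrite mulNr addrC.
Qed.

Lemma reg_ext l i h : mup (E l) = 0%E -> mum (E l) = 0%E ->
  L2 mup (rpow l 1) -> L2 mum (rpow l 1) ->
  cint mup setT (rpow l 1) = cint mum setT (rpow l 1) ->
  ahat_eqn l h (reg_chain l i) ->
  [/\ L2 mup (rpow l i.+2), L2 mum (rpow l i.+2) &
      cint mum setT (rpow l i.+2) = cint mup setT (rpow l i.+2)].
Proof.
move=> p0 m0 Lp Lm I1 [c [c1 c2 I]].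
have [Lp' Ip] := reg_ext_comp _ _ _ _ _ wp p0 Lp c1.
have [Lm' Im] := reg_ext_comp _ _ _ _ _ wm m0 Lm c2.
by split=> //; rewrite Ip Im I I1.
Qed.

(** A kernel vector that is not null has c nonzero, and division by c transfers square integrability
    and equality of integrals from it to the resolvent. *)
Lemma reg_kernel l : mup (E l) = 0%E -> mum (E l) = 0%E ->
  forall h, rel_ker_pow (Z := Z) (B := ahat_eqn l) 1 h ->
  exists c : R[i], Z (h - c *: reg_chain l 0) /\
    (~ Z h -> [/\ L2 mup (rpow l 1), L2 mum (rpow l 1) &
      cint mup setT (rpow l 1) = cint mum setT (rpow l 1)]).
Proof.
move=> p0 m0 h /ahat_eqn_kernel[c [a [b [c1 c2 I ha hb]]]]; exists c.
have ha' := eqn_comp_sol_nomass _ _ _ _ _ p0 ha.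
have hb' := eqn_comp_sol_nomass _ _ _ _ _ m0 hb.
split.
  by split; [apply: (ae_imp ha')|apply: (ae_imp hb')] => t ht;
    apply/eqP; rewrite subr_eq0; apply/eqP.
move=> Zh; have [cz|cn0] := eqVneq c 0.
  exfalso; apply: Zh; split; [apply: (ae_imp ha')|apply: (ae_imp hb')] => t ->;
  by rewrite cz mul0r.
have L1 : L2 mup h.1 by case: c1.
have L1' : L2 mum h.2 by case: c2.
have Lp := L2_rpow1_of_multiple _ _ _ _ _ wp cn0 L1 ha.
have Lm := L2_rpow1_of_multiple _ _ _ _ _ wm cn0 L1' hb.
split=> //; apply: (mulfI cn0).
have Ip := eqn_comp_cintegrable wp _ _ _ _ (eqn_comp_rpow1 wp l Lp).
have Im := eqn_comp_cintegrable wm _ _ _ _ (eqn_comp_rpow1 wm l Lm).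
have mc : cmeasurable (fun t => c * rpow l 1 t).
  by apply: cmeasurableM (cmeasurable_cst _) _; exact: cmeasurable_rpow.
have m1 : cmeasurable h.1 by case: c1 => -[].
have m2 : cmeasurable h.2 by case: c2 => -[].
by rewrite -!cintZ// -(cint_ae _ _ m1 mc ha') -(cint_ae _ _ m2 mc hb').
Qed.

(** * Chains at a point charged by both measures *)

Local Notation mass mu l := (rC (fine (mu (E l)))).

Lemma mass_neq0 (mu : LSmeasure R) l : fin_int mu setT (fun t => (1 + `|t|)^-1) ->
  mu (E l) <> 0%E -> mass mu l != 0.
Proof.
move=> w mu0; apply/eqP => /(congr1 (@complex.Re R))/= fn0; apply: mu0.
by rewrite -[LHS]fineK ?fn0// ge0_fin_numE// point_mass_fin.
Qed.

(** The weights normalise both integrals to 1, so this is an eigenvector whether or not the masses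
    agree. *)
Definition point_vec l : vec R :=
  (fun t => (mass mup l)^-1 * point_ind l t, fun t => (mass mum l)^-1 * point_ind l t).

Lemma point_vec_eqn l : mup (E l) <> 0%E -> mum (E l) <> 0%E -> ahat_eqn l (point_vec l) 0.
Proof.
move=> p0 m0; exists 0; split; [exact: eqn_comp_point_ind|exact: eqn_comp_point_ind|].
rewrite /= !cintZ ?cint_point_ind//; try exact: cintegrable_point_ind.
by rewrite !mulVf// mass_neq0.
Qed.

Lemma point_vec_nonzero l : mup (E l) <> 0%E -> ~ Z (point_vec l).
Proof.
move=> p0 [/= /(ae_at_point _ _ _ p0)[t tl]]; rewrite point_indE// mulr1 => /eqP.
by rewrite invr_eq0 (negPf (mass_neq0 _ _ wp p0)).
Qed.

Lemma point_kernel l : mup (E l) <> 0%E -> mum (E l) <> 0%E ->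
  forall h, rel_ker_pow (Z := Z) (B := ahat_eqn l) 1 h ->
  exists a : R[i], Z (h - a *: point_vec l).
Proof.
move=> p0 m0 h /ahat_eqn_kernel[c [a [b [c1 c2 I ha hb]]]].
have c0 := eqn_comp_mass _ _ _ _ p0 c1.
have {}ha : ae_eq mup h.1 (fun t => a * point_ind l t).
  by apply: (ae_imp ha) => t ->; rewrite c0 mul0r add0r.
have {}hb : ae_eq mum h.2 (fun t => b * point_ind l t).
  by apply: (ae_imp hb) => t ->; rewrite c0 mul0r add0r.
have m1 : cmeasurable h.1 by case: c1 => -[].
have m2 : cmeasurable h.2 by case: c2 => -[].
have mi k : cmeasurable (fun t => k * point_ind l t).
  by apply: cmeasurableM (cmeasurable_cst _) _; apply: cmeasurable_rC; exact: measurable_point_ind.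
have ab : a * mass mup l = b * mass mum l.
  move: I; rewrite (cint_ae _ _ m1 (mi a) ha) (cint_ae _ _ m2 (mi b) hb).
  by rewrite !cintZ ?cint_point_ind//; exact: cintegrable_point_ind.
have np := mass_neq0 _ _ wp p0; have nm := mass_neq0 _ _ wm m0.
exists (a * mass mup l); split.
  apply: (ae_imp ha) => t ht.
  rewrite -[LHS]/(h.1 t - a * mass mup l * ((mass mup l)^-1 * point_ind l t)) ht.
  by rewrite -mulrA [mass mup l * _]mulrA mulfV// mul1r subrr.
apply: (ae_imp hb) => t ht; rewrite ab.
rewrite -[LHS]/(h.2 t - b * mass mum l * ((mass mum l)^-1 * point_ind l t)) ht.
by rewrite -mulrA [mass mum l * _]mulrA mulfV// mul1r subrr.
Qed.

(** Evaluation at [l] on each side equates the inverse masses with the same [-c]. Hence the masses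
    agree and c is nonzero; off [l] the preimage is c times the resolvent, which is therefore in
    L^2. *)
Lemma point_vec_ext l h : mup (E l) <> 0%E -> mum (E l) <> 0%E ->
  ahat_eqn l h (point_vec l) ->
  [/\ mum (E l) = mup (E l), L2 mup (rpow l 1) & L2 mum (rpow l 1)].
Proof.
move=> p0 m0 [c [c1 c2 I]].
have np := mass_neq0 _ _ wp p0; have nm := mass_neq0 _ _ wm m0.
have [t tl /=] := eqn_comp_at_point _ _ _ _ p0 c1; rewrite point_indE// mulr1 => cp.
have [s sl /=] := eqn_comp_at_point _ _ _ _ m0 c2; rewrite point_indE// mulr1 => cm.
have cn0 : c != 0 by rewrite -oppr_eq0 -cp invr_eq0.
have L (mu : LSmeasure R) (k : R[i]) (h1 : R -> R[i]) :
    fin_int mu setT (fun t => (1 + `|t|)^-1) ->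
    eqn_comp mu l c h1 (fun t => k * point_ind l t) -> L2 mu (rpow l 1).
  move=> w ch; have [a ha] := eqn_comp_sol _ _ _ _ ch.
  have Lh : L2 mu h1 by case: ch.
  apply: (L2_rpow1_of_multiple _ _ _ _ a w cn0 Lh).
  apply: (ae_imp ha) => r ->; rewrite rpow1 mulrDl -mulrA [point_ind l r * _]mulrC.
  have -> : (rC r - l)^-1 * point_ind l r = 0.
    have [rl|/eqP rl] := eqVneq (rC r) l; first by rewrite rl subrr invr0 mul0r.
    by rewrite point_ind0// mulr0.
  by rewrite mulr0 add0r.
split; [|exact: L c1|exact: L c2].
have /(congr1 (@complex.Re R))/= : mass mum l = mass mup l by apply: invr_inj; rewrite cp cm.
by move=> fE; rewrite -[LHS]fineK ?fE ?fineK// ge0_fin_numE// point_mass_fin.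
Qed.

(* Multiples of the point indicator solve the homogeneous equation, so the
   second component may be adjusted at [l] to equate the two integrals. *)
Definition sing_shift l (i : nat) : R[i] :=
  (cint mup setT (rpow l i) - cint mum setT (rpow l i)) / mass mum l.

(** The start is minus the indicator because that is the defect left by the resolvent with c = 1.
    The i-th power sits at index i, one place later than in [reg_chain]. *)
Definition sing_chain l (i : nat) : vec R :=
  if i is 0 then (fun t => - point_ind l t, fun t => - point_ind l t)
  else (rpow l i, fun t => sing_shift l i * point_ind l t + rpow l i t).

Lemma eqn_comp_point_shift (mu : LSmeasure R) l c b (f g : R -> R[i]) :
  fin_int mu setT (fun t => (1 + `|t|)^-1) -> eqn_comp mu l c f g ->
  eqn_comp mu l c (fun t => b * point_ind l t + f t) g.
Proof.
move=> w cf; have := eqn_comp_linear _ 1 _ _ _ _ _ _ (eqn_comp_point_ind w l b) cf.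
rewrite mulr0 add0r; under eq_fun => t do rewrite mul1r.
by under [X in eqn_comp _ _ _ _ X]eq_fun => t do rewrite add0r.
Qed.

Lemma sing_chain_cint l i : mum (E l) <> 0%E ->
  cintegrable mum (rpow l i.+1) ->
  cint mup setT (sing_chain l i.+1).1 = cint mum setT (sing_chain l i.+1).2.
Proof.
move=> m0 Im; have Ip := cintegrable_point_ind wm l.
rewrite /= cintD//; last exact: cintegrableZ.
by rewrite cintZ// cint_point_ind// divfK ?mass_neq0// subrK.
Qed.

Lemma sing_chain_step0 l : mum (E l) <> 0%E ->
  L2 mup (rpow l 1) -> L2 mum (rpow l 1) -> ahat_eqn l (sing_chain l 1) (sing_chain l 0).
Proof.
move=> m0 Lp Lm; have Im := eqn_comp_rpow1 wm l Lm.
exists 1; split; [exact: eqn_comp_rpow1|exact: eqn_comp_point_shift|].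
exact: sing_chain_cint (eqn_comp_cintegrable wm _ _ _ _ Im).
Qed.

(** Equality of the lower integrals makes the shift in the target vanish, so the target is a bare
    power. The integrals of the new power need not agree, since its own shift repairs them. *)
Lemma sing_chain_step l i : mum (E l) <> 0%E ->
  L2 mup (rpow l i.+1) -> L2 mum (rpow l i.+1) ->
  L2 mup (rpow l i.+2) -> L2 mum (rpow l i.+2) ->
  cint mum setT (rpow l i.+1) = cint mup setT (rpow l i.+1) ->
  ahat_eqn l (sing_chain l i.+2) (sing_chain l i.+1).
Proof.
move=> m0 Lp Lm Lp' Lm' I; have cm := eqn_comp_rpow l i Lm Lm'.
exists 0; split; [exact: eqn_comp_rpow| |].
  rewrite /= (_ : (fun t => sing_shift l i.+1 * _ + _) = rpow l i.+1).
    exact: eqn_comp_point_shift.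
  by apply/funext => t; rewrite /sing_shift I subrr !mul0r add0r.
exact: sing_chain_cint (eqn_comp_cintegrable wm _ _ _ _ cm).
Qed.

Lemma sing_ext_L2 (mu : LSmeasure R) l i (h : R -> R[i]) :
  fin_int mu setT (fun t => (1 + `|t|)^-1) ->
  eqn_comp mu l 0 h (rpow l i.+1) -> L2 mu (rpow l i.+2).
Proof.
move=> w ch; have [a ha] := eqn_comp_sol _ _ _ _ ch.
have Lh : L2 mu h by case: ch.
apply: (L2_ae _ _ (L2_linear (- a) _ _ (L2_point_ind w l) Lh) (cmeasurable_rpow _ _)).
by apply: (ae_imp ha) => t ->; rewrite addr0 (rpowS _ i.+1); ring.
Qed.

(** Powers vanish at [l], so evaluation there gives c = 0 on the first side and then a zero shift on
    the second, which is the equality of integrals. *)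
Lemma sing_ext l i h : mup (E l) <> 0%E -> mum (E l) <> 0%E ->
  ahat_eqn l h (sing_chain l i.+1) ->
  [/\ L2 mup (rpow l i.+2), L2 mum (rpow l i.+2) &
      cint mum setT (rpow l i.+1) = cint mup setT (rpow l i.+1)].
Proof.
move=> p0 m0 [c [c1 c2 _]].
have [t tl /=] := eqn_comp_at_point _ _ _ _ p0 c1.
rewrite rpow_point// => /esym/eqP; rewrite oppr_eq0 => /eqP c0.
have [s sl /=] := eqn_comp_at_point _ _ _ _ m0 c2.
rewrite rpow_point// point_indE// mulr1 addr0 c0 oppr0 => b0.
rewrite c0 in c1 c2; split; first exact: sing_ext_L2 c1.
  apply: (sing_ext_L2 _ _ _ h.2 wm); move: c2; rewrite /= b0.
  by under [X in eqn_comp _ _ _ _ X]eq_fun => r do rewrite mul0r add0r.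
move/eqP: b0; rewrite mulf_eq0 invr_eq0 (negPf (mass_neq0 _ _ wm m0)) orbF.
by rewrite subr_eq0 => /eqP.
Qed.

Lemma sing_chain0_eqn l : mup (E l) <> 0%E -> mum (E l) <> 0%E ->
  mum (E l) = mup (E l) -> ahat_eqn l (sing_chain l 0) 0.
Proof.
(* Equal masses make the two weights of [point_vec] coincide, and scaling by minus the mass removes
   both. *)
move=> p0 m0 pm; have := ahat_eqn_linear _ (- mass mup l) _ _ _ _ (point_vec_eqn _ p0 m0) (ahat_eqn0 l).
rewrite scaler0 !addr0; congr (ahat_eqn l _ 0).
have np := mass_neq0 _ _ wp p0.
congr pair; apply/funext => t; rewrite ?pm;
  by rewrite -[LHS]/(- mass mup l * (_ * _)) mulrA mulNr ?pm mulfV// mulN1r.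
Qed.

Lemma sing_kernel l : mup (E l) <> 0%E -> mum (E l) <> 0%E ->
  mum (E l) = mup (E l) ->
  forall h, rel_ker_pow (Z := Z) (B := ahat_eqn l) 1 h ->
  exists a : R[i], Z (h - a *: sing_chain l 0).
Proof.
move=> p0 m0 pm h /(point_kernel _ p0 m0)[a [z1 z2]].
exists (- (a * (mass mup l)^-1)); split; [apply: (ae_imp z1)|apply: (ae_imp z2)] => t <-.
  by rewrite -[LHS]/(h.1 t - - (a * (mass mup l)^-1) * - point_ind l t)
    -[RHS]/(h.1 t - a * ((mass mup l)^-1 * point_ind l t)); ring.
by rewrite -[LHS]/(h.2 t - - (a * (mass mup l)^-1) * - point_ind l t)
    -[RHS]/(h.2 t - a * ((mass mum l)^-1 * point_ind l t)) pm; ring.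
Qed.

Lemma sing_chain0_nonzero l : mup (E l) <> 0%E -> ~ Z (sing_chain l 0).
Proof.
move=> p0 [/= /(ae_at_point _ _ _ p0)[t tl]]; rewrite point_indE// => /eqP.
by rewrite oppr_eq0 oner_eq0.
Qed.

Lemma fin_int_off_point (mu : LSmeasure R) l j :
  fin_int mu (~` E l) (fun t => (csq (rC t - l) ^+ j.+1)^-1) <-> L2 mu (rpow l j.+1).
Proof.
rewrite L2_rpow; apply: fin_int_setC_vanish => t tl.
by rewrite tl subrr (csq_eq0 0).2// expr0n invr0.
Qed.

Lemma fin_int_off_point1 (mu : LSmeasure R) l :
  fin_int mu (~` E l) (invsq l) <-> L2 mu (rpow l 1).
Proof.
rewrite -invsq_L2; apply: fin_int_setC_vanish => t tl.
by rewrite /invsq tl subrr (csq_eq0 0).2// invr0.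
Qed.

Lemma cint_off_point (mu : LSmeasure R) l j :
  cint mu (~` E l) (rpow l j.+1) = cint mu setT (rpow l j.+1).
Proof. by apply: cint_setC_vanish => t; exact: rpow_point. Qed.

End Coupling.

(** * The point spectrum *)

Section PointSpectrum.
Context {R : realType} {mup mum : LSmeasure R} {Cp Cm : R}.
Hypotheses (wp : fin_int mup setT (fun t => (1 + `|t|)^-1))
           (wm : fin_int mum setT (fun t => (1 + `|t|)^-1)).
Hypotheses (mupT : mup setT = +oo%E) (mumT : mum setT = +oo%E).
Hypotheses (CpE : Cp = Rintegral mup setT (fun t => t / (1 + t ^+ 2)))
           (CmE : Cm = Rintegral mum setT (fun t => t / (1 + t ^+ 2))).

Local Notation A := (Ahat_graph mup Cp mum Cm).
Local Notation Z := (vzero mup mum).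
Local Notation B l := (ahat_eqn (mup := mup) (mum := mum) l).

Let BE l f g : A f (vadd (vscale l f) g) <-> B l f g.
Proof. exact: Ahat_eqnP. Qed.

Let Z0 : Z 0 := vzero0.

Let Zlin : forall (a : R[i]) (f g : vec R), Z f -> Z g -> Z (a *: f + g) := vzero_linear.

Let B0 := ahat_eqn0 (mup := mup) (mum := mum).

Let Blin := ahat_eqn_linear wp wm.

Let BZ := ahat_eqn_vzero (mup := mup) (mum := mum).

Let Bfun := ahat_eqn_functional mupT mumT.

Let rootE l := root_nE (Z := Z) (BE l).

Lemma no_point_spec l : (forall f, rel_ker_pow (Z := Z) (B := B l) 1 f -> Z f) ->
  ~ point_spec Z A l.
Proof. by move=> nz [f [Zf /rootE/nz]]. Qed.

Lemma no_sigma_p_mass (mu : LSmeasure R) l :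
  fin_int mu setT (fun t => (1 + `|t|)^-1) -> ~ sigma_p_Q mu l ->
  mu [set t : R | rC t = l] = 0%E.
Proof. by move=> w ns; apply: contrapT => /(sigma_p_QP w l).2. Qed.

(** A nonzero c would put the resolvent in L^2 on both sides, so divergence on one side suffices; on
    that side [l] is also not an atom. *)
Lemma frakA0_not_eigenvalue :
  forall l : R[i], frakA0 mup l \/ frakA0 mum l -> ~ point_spec Z A l.
Proof.
move=> l H; apply: no_point_spec; apply: (no_eigenvalue wp wm).
  move=> f c a b c1 c2 fa fb; apply/eqP/negP => /negP c0.
  case: H => -[_ nfin]; apply/nfin/invsq_L2.
    by apply: (L2_rpow1_of_multiple _ _ _ _ _ wp c0 _ fa); case: c1.
  by apply: (L2_rpow1_of_multiple _ _ _ _ _ wm c0 _ fb); case: c2.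
by case: H => -[[ns _] _]; [left|right]; exact: no_sigma_p_mass ns.
Qed.

Lemma frakAp_eigenvalue :
  forall l : R[i], frakAp mup l /\ frakAp mum l ->
     let D := ~` [set t : R | rC t = l] in
     (point_spec Z A l /\ geom_mult Z A l (Some 1%N)) /\
     (alg_mult Z A l (Some 1%N) <->
        ~ [/\ mum [set t : R | rC t = l] = mup [set t : R | rC t = l],
              fin_int mup D (invsq l) & fin_int mum D (invsq l)]) /\
     ([/\ mum [set t : R | rC t = l] = mup [set t : R | rC t = l],
          fin_int mup D (invsq l) & fin_int mum D (invsq l)] ->
      let cond (j : nat) :=
        [/\ fin_int mup D (fun t => (csq (rC t - l) ^+ j)^-1),
            fin_int mum D (fun t => (csq (rC t - l) ^+ j)^-1) &
            cint mum D (fun t => ((rC t - l) ^+ j.-1)^-1)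
            = cint mup D (fun t => ((rC t - l) ^+ j.-1)^-1)] in
      exists m, greatest_from 2
                  (fun k => forall j : nat, (2 <= j)%N -> jle j.+1 k -> cond j) m
                /\ alg_mult Z A l m).
Proof.
move=> l [/(sigma_p_QP wp l) p0 /(sigma_p_QP wm l) m0] D.
have e0 := point_vec_eqn wp wm l p0 m0; have en := point_vec_nonzero wp l p0 (mum := mum).
have ek := point_kernel wp wm l p0 m0.
split; [split|split].
+ exact: (eigenvector_point_spec Z0 (BE l)
    (fun=> point_vec l (mup := mup) (mum := mum)) en e0).
+ exact: (eigenline_geom_mult Z0 Zlin (B0 l) (Blin l) (Bfun l) (BE l)
    (fun=> point_vec l (mup := mup) (mum := mum)) en e0 ek).
+ split=> [[_ ns] [pm /fin_int_off_point1 Lp /fin_int_off_point1 Lm]|nC].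
    (* Two independent root vectors, the indicator and the resolvent vector above it, contradict
       dimension one. *)
    apply: ns; apply: (chain_alg_indep Z0 Zlin (B0 l) (Blin l) (Bfun l) (BE l)
      (sing_chain l (mup := mup) (mum := mum))).
    * exact: sing_chain0_nonzero.
    * exact: sing_chain0_eqn.
    * by move=> [|i]// _; exact: sing_chain_step0.
  (* A chain of length one: only entry 0 of the constant sequence counts. *)
  apply: (maximal_chain_alg_mult Z0 Zlin (B0 l) (Blin l) (BZ l) (Bfun l) (BE l)
    (fun=> point_vec l (mup := mup) (mum := mum)) en e0 ek) => //.
  move=> h /(point_vec_ext wp wm l h p0 m0)[pm Lp Lm].
  by apply: nC; split=> //; exact/fin_int_off_point1.
+ move=> [pm /fin_int_off_point1 Lp /fin_int_off_point1 Lm] cond.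
  have condE j : cond j.+2 <-> [/\ L2 mup (rpow l j.+2), L2 mum (rpow l j.+2) &
      cint mum setT (rpow l j.+1) = cint mup setT (rpow l j.+1)].
    split=> [[/fin_int_off_point Lp' /fin_int_off_point Lm' I]|[Lp' Lm' I]].
      by split=> //; rewrite -!cint_off_point.
    split; [exact/fin_int_off_point|exact/fin_int_off_point|].
    by move: I; rewrite -!cint_off_point.
  (* The step from index 0 to 1 is already granted by the three conditions, hence [True]; the step
     from i to i + 1 with i positive is [cond i.+1]. *)
  apply: (greatest_chain_alg_mult Z0 Zlin (B0 l) (Blin l) (BZ l) (Bfun l) (BE l)
    (sing_chain l (mup := mup) (mum := mum)) _ _ _ _
    (fun i => if i is j.+1 then cond j.+2 else True)).
  * exact: sing_chain0_nonzero.
  * exact: sing_chain0_eqn.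
  * exact: sing_kernel.
  * by case.
  * move=> m _; split=> [Q [|i] im//|Q [|[|j]]// _ jm]; first exact: Q.
    exact: (Q j.+1).
  * move=> [|i] H; first exact: sing_chain_step0.
    have /condE[Lp' Lm' I] := H _ (leqnn _).
    suff [Lp1 Lm1] : L2 mup (rpow l i.+1) /\ L2 mum (rpow l i.+1).
      exact: sing_chain_step.
    case: i H {Lp' Lm' I} => [|i] H //.
    by have /condE[] := H _ (leqnSn _).
  * by move=> [|i] h _ //; move=> /(sing_ext wp wm l i h p0 m0) => ?; exact/condE.
Qed.

Lemma frakAr_eigenvalue :
  forall l : R[i], frakAr mup l /\ frakAr mum l ->
     (point_spec Z A l <->
        cint mup setT (fun t => (rC t - l)^-1) =
        cint mum setT (fun t => (rC t - l)^-1)) /\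
     (point_spec Z A l ->
        let cond (j : nat) :=
          [/\ fin_int mup setT (fun t => (csq (rC t - l) ^+ j)^-1),
              fin_int mum setT (fun t => (csq (rC t - l) ^+ j)^-1) &
              cint mum setT (fun t => ((rC t - l) ^+ j)^-1)
              = cint mup setT (fun t => ((rC t - l) ^+ j)^-1)] in
        geom_mult Z A l (Some 1%N) /\
        exists m, greatest_from 1
                    (fun k => forall j : nat, (1 <= j)%N -> jle j k -> cond j) m
                  /\ alg_mult Z A l m).
Proof.
move=> l [[nsp /invsq_L2 Lp] [nsm /invsq_L2 Lm]].
have p0 := no_sigma_p_mass _ _ wp nsp; have m0 := no_sigma_p_mass _ _ wm nsm.
have spec_int : point_spec Z A l ->
    cint mup setT (rpow l 1) = cint mum setT (rpow l 1).
  by move=> [f [Zf /rootE/(reg_kernel wp wm l p0 m0)[c [_ /(_ Zf)[]]]]].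
have f0 := reg_chain0 wp wm l p0 m0 Lp Lm.
have fn : ~ Z (reg_chain l 0).
  apply: (reg_chain0_nonzero mupT).
  apply: (eqn_comp_ae _ _ _ _ _ _ (eqn_comp_rpow1 wp l Lp) (cmeasurable_rpow _ _) (ae_refl _)).
  by apply: (ae_imp (ae_point_ind0 l 1 p0)) => t; rewrite mul1r => ->; rewrite oppr0.
have fk h : rel_ker_pow (Z := Z) (B := ahat_eqn (mup := mup) (mum := mum) l) 1 h ->
    exists a : R[i], Z (h - a *: reg_chain l 0).
  by move=> /(reg_kernel wp wm l p0 m0)[c [? _]]; exists c.
split.
  split=> [/spec_int //|I].
  exact: (eigenvector_point_spec Z0 (BE l) (reg_chain l) fn (f0 I)).
move=> /spec_int I cond.
have condE j : cond j <-> [/\ L2 mup (rpow l j), L2 mum (rpow l j) &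
    cint mum setT (rpow l j) = cint mup setT (rpow l j)].
  by split=> -[? ? ?]; split=> //; exact/L2_rpow.
(* The case j = 1 is the eigenvalue condition itself, so the first genuine extension, at index 0, is
   governed by [cond 2]. *)
have cond1 : cond 1%N by apply/condE.
split; first exact: (eigenline_geom_mult Z0 Zlin (B0 l) (Blin l) (Bfun l) (BE l)
    (reg_chain l) fn (f0 I) fk).
apply: (greatest_chain_alg_mult Z0 Zlin (B0 l) (Blin l) (BZ l) (Bfun l) (BE l)
    (reg_chain l) fn (f0 I) fk _ (fun i => cond i.+2)).
+ by [].
+ move=> m lom; split=> [Q i im|Q [|[|j]]// _ jm]; first exact: Q.
  exact: (Q j).
+ move=> i H; have /condE[Lp' Lm' I'] := H _ (leqnn _).
  suff /condE[Lp1 Lm1 _] : cond i.+1 by exact: reg_chain_step.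
  by case: i H {Lp' Lm' I'} => [|i] H //; exact: (H _ (leqnSn _)).
+ by move=> i h _ /(reg_ext wp wm l i h p0 m0 Lp Lm I) => ?; exact/condE.
Qed.

(** The atom on one side forces c = 0, and its absence on the other side then leaves no nonzero
    vector with equal integrals. *)
Lemma frakApr_not_eigenvalue :
  forall l : R[i], (frakAp mup l /\ frakAr mum l) \/ (frakAp mum l /\ frakAr mup l) ->
     ~ point_spec Z A l.
Proof.
move=> l H; apply: no_point_spec; apply: (no_eigenvalue wp wm).
  move=> f c a b c1 c2 _ _; case: H => -[/sigma_p_QP sp _].
    exact: (eqn_comp_mass _ _ _ _ (sp wp) c1).
  exact: (eqn_comp_mass _ _ _ _ (sp wm) c2).
by case: H => -[_ [ns _]]; [right|left]; exact: no_sigma_p_mass ns.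
Qed.

End PointSpectrum.

Theorem theorem3p1 (R : realType)
  (Sp Sm : R -> R) (Fp Fm : cumulative R R) (Cp Cm : R) :
  (* Sigma_+ *)
  {homo Sp : x y / x <= y} ->
  (forall t, Sp t = (lim (Sp x @[x --> t^'-]) + lim (Sp x @[x --> t^'+])) / 2) ->
  Sp 0 = 0 ->
  (forall t, Sp x @[x --> t^'+] --> Fp t) ->
  (* Sigma_- *)
  {homo Sm : x y / x <= y} ->
  (forall t, Sm t = (lim (Sm x @[x --> t^'-]) + lim (Sm x @[x --> t^'+])) / 2) ->
  Sm 0 = 0 ->
  (forall t, Sm x @[x --> t^'+] --> Fm t) ->
  let mup := lebesgue_stieltjes_measure Fp in
  let mum := lebesgue_stieltjes_measure Fm in
  fin_int mup setT (fun t => (1 + t ^+ 2)^-1) ->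
  fin_int mum setT (fun t => (1 + t ^+ 2)^-1) ->
  mup setT = +oo%E ->
  mum setT = +oo%E ->
  fin_int mup setT (fun t => (1 + `|t|)^-1) ->
  fin_int mum setT (fun t => (1 + `|t|)^-1) ->
  Cp = Rintegral mup setT (fun t => t / (1 + t ^+ 2)) ->
  Cm = Rintegral mum setT (fun t => t / (1 + t ^+ 2)) ->
  let A := Ahat_graph mup Cp mum Cm in
  let Z := vzero mup mum in
  (* 1) *)
  (forall l : R[i], frakA0 mup l \/ frakA0 mum l -> ~ point_spec Z A l) /\
  (* 2) *)
  (forall l : R[i], frakAp mup l /\ frakAp mum l ->
     let D := ~` [set t : R | rC t = l] in
     (point_spec Z A l /\ geom_mult Z A l (Some 1%N)) /\
     (alg_mult Z A l (Some 1%N) <->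
        ~ [/\ mum [set t : R | rC t = l] = mup [set t : R | rC t = l],
              fin_int mup D (invsq l) & fin_int mum D (invsq l)]) /\
     ([/\ mum [set t : R | rC t = l] = mup [set t : R | rC t = l],
          fin_int mup D (invsq l) & fin_int mum D (invsq l)] ->
      let cond (j : nat) :=
        [/\ fin_int mup D (fun t => (csq (rC t - l) ^+ j)^-1),
            fin_int mum D (fun t => (csq (rC t - l) ^+ j)^-1) &
            cint mum D (fun t => ((rC t - l) ^+ j.-1)^-1)
            = cint mup D (fun t => ((rC t - l) ^+ j.-1)^-1)] in
      exists m, greatest_from 2
                  (fun k => forall j : nat, (2 <= j)%N -> jle j.+1 k -> cond j) m
                /\ alg_mult Z A l m)) /\
  (* 3) *)
  (forall l : R[i], frakAr mup l /\ frakAr mum l ->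
     (point_spec Z A l <->
        cint mup setT (fun t => (rC t - l)^-1) =
        cint mum setT (fun t => (rC t - l)^-1)) /\
     (point_spec Z A l ->
        let cond (j : nat) :=
          [/\ fin_int mup setT (fun t => (csq (rC t - l) ^+ j)^-1),
              fin_int mum setT (fun t => (csq (rC t - l) ^+ j)^-1) &
              cint mum setT (fun t => ((rC t - l) ^+ j)^-1)
              = cint mup setT (fun t => ((rC t - l) ^+ j)^-1)] in
        geom_mult Z A l (Some 1%N) /\
        exists m, greatest_from 1
                    (fun k => forall j : nat, (1 <= j)%N -> jle j k -> cond j) m
                  /\ alg_mult Z A l m)) /\
  (* 4) *)
  (forall l : R[i], (frakAp mup l /\ frakAr mum l) \/ (frakAp mum l /\ frakAr mup l) ->
     ~ point_spec Z A l).
Proof.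
move=> _ _ _ _ _ _ _ _ mup mum _ _ mupT mumT wp wm CpE CmE A Z.
exact: (conj (frakA0_not_eigenvalue wp wm CpE CmE)
  (conj (frakAp_eigenvalue wp wm mupT mumT CpE CmE)
  (conj (frakAr_eigenvalue wp wm mupT mumT CpE CmE)
        (frakApr_not_eigenvalue wp wm CpE CmE)))).
Qed.
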